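(* Let $M\ge 1$ be an integer and let $q\in(1,M+1]$. The following statements are equivalent: (i) $q\in\overline{\mathcal{U}}$, $q\ne q'$, and $q$ is not the right endpoint $q_0^*$ of any connected component $(q_0,q_0^* )$ of $(1,M+1]\setminus\overline{\mathcal U}$ other than $(1,q')$; (ii) $\dim_H\pi_{M+1}(\mathcal{U}_q'\setminus\mathcal{U}_p')>0$ for every $p\in(1,q)$; (iii) $\dim_H\big(\mathcal{U}\cap(p,q)\big)>0$ for every $p\in(1,q)$.
   Context: Fix an integer $M\ge1$. For $q>1$ and a sequence $(d_i)\in\{0,1,\ldots,M\}^\infty$ write $\pi_q((d_i))=\sum_{i=1}^\infty d_iq^{-i}$; $(d_i)$ is called a $q$-expansion of $x$ if $x=\pi_q((d_i))$. For $q\in(1,M+1]$, $\mathcal{U}_q'$ denotes the set of sequences $(d_i)\in\{0,\ldots,M\}^\infty$ such that $(d_i)$ is the unique $q$-expansion (with digits in $\{0,\ldots,M\}$) of $\pi_q((d_i))$. $\mathcal{U}$ denotes the set of $q>1$ such that $1$ has a unique $q$-expansion with digits in $\{0,\ldots,M\}$; $\mathcal U\subseteq(1,M+1]$, $M+1\in\mathcal U$, and $\mathcal U$ has a smallest element $q'$ (the Komornik–Loreti constant). $\overline{\mathcal U}$ is the closure of $\mathcal U$. The open set $(1,M+1]\setminus\overline{\mathcal U}$ is the disjoint union of $(1,q')$ and of countably many further open intervals $(q_0,q_0^* )$ (its other connected components). $\dim_H$ denotes Hausdorff dimension in $\mathbb R$. *)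

(* Defs.v *)
From mathcomp Require Import all_boot all_order all_algebra.
From mathcomp Require Import all_classical all_reals all_analysis.
Set Implicit Arguments.
Unset Strict Implicit.
Unset Printing Implicit Defensive.
Import Order.TTheory GRing.Theory Num.Theory.
Import numFieldNormedType.Exports.
Local Open Scope classical_set_scope.
Local Open Scope ring_scope.

(* Digits are indexed from 0: the digit d_(i+1) of a sequence d_1 d_2 ... is
   d i, and it has weight q ^- i.+1. The series converges when 1 < q. *)
Definition pi_base (R : realType) (M : nat) (q : R) (d : nat -> 'I_M.+1) : R :=
  limn (series (fun i : nat => (d i)%:R * q ^- i.+1)).

Definition univoque_seq (R : realType) (M : nat) (q : R) :
    set (nat -> 'I_M.+1) :=
  [set d | forall e : nat -> 'I_M.+1, pi_base q e = pi_base q d -> e = d].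
Arguments univoque_seq {R} M q _.

Definition univoque_base (R : realType) (M : nat) : set R :=
  [set q | 1 < q /\ exists! d : nat -> 'I_M.+1, pi_base q d = 1].
Arguments univoque_base R M _ : clear implicits.

(* The smallest element of univoque_base R M; the default value 0 is only used
   if there is no such element. *)
Definition komornik_loreti (R : realType) (M : nat) : R :=
  xget 0 (univoque_base R M `&` lbound (univoque_base R M)).

Definition univoque_gap (R : realType) (M : nat) : set R :=
  `]1, M.+1%:R] `\` closure (univoque_base R M).
Arguments univoque_gap R M _ : clear implicits.

Definition components (T : topologicalType) (A : set T) : set (set T) :=
  connected_component A @` A.

Section hausdorff_dimension.
Variable R : realType.
Local Open Scope ereal_scope.

(* As the supremum is taken in \bar R, diam set0 = -oo. *)
Definition diam (A : set R) : \bar R :=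
  ereal_sup [set `|x - y|%:E | x in A & y in A].

(* The empty set has weight 0 for all s, while a singleton has weight 1 for
   s = 0, since 0 `^ 0 = 1: the 0-dimensional measure is the counting
   measure. *)
Definition hausdorff_weight (s : R) (A : set R) : \bar R :=
  if A == set0 then 0 else diam A `^ s.

Definition hausdorff_content (s delta : R) (E : set R) : \bar R :=
  ereal_inf [set \sum_(0 <= i <oo) hausdorff_weight s (C i) |
    C in [set C : nat -> set R |
      E `<=` \bigcup_i C i /\ forall i, diam (C i) <= delta%:E]].

Definition hausdorff_measure (s : R) (E : set R) : \bar R :=
  ereal_sup [set hausdorff_content s delta E |
    delta in [set delta : R | (0 < delta)%R]].

Definition hausdorff_dim (E : set R) : \bar R :=
  ereal_inf [set s%:E |
    s in [set s : R | (0 <= s)%R /\ hausdorff_measure s E = 0]].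

End hausdorff_dimension.

(* Main.v *)
(* Combinatorially, the univoque bases r < M + 1 correspond to the sequences c
   with c' < sigma^k c < c for all k >= 1, where c' is the reflection of c; here
   c is the expansion of 1 in base r. All three conditions are equivalent to:
   univoque bases accumulate at q from the left.

   If r is a univoque base in ]p, q[, then the expansion c of 1 in base r has
   arbitrarily long prefixes t whose proper suffixes are strictly larger than
   the reflected prefixes of the same length. Writing t^- for t with its last
   digit lowered and t' for the reflection of t, every sequence which starts
   with t t'^- t'^- t' and continues with blocks t t' t t' or t t'^- t' t^- is
   again of the above form, so it is the expansion of 1 in a univoque base, which
   lies in ]p, q[ when t is long. This gives a Cantor set of positive dimension,
   both of bases and of sequences.

   Conversely let ]p, q[ contain no univoque base, and let c be the quasi-greedy
   expansion of 1 in base q. For p' close to q, the sequences that are univoque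
   for q but not for p' have, up to reflection, a tail that starts with a long
   prefix of c and whose shifts lie between c' and c. If c' < sigma^k c fails for
   some k >= 1 there is no such tail. Otherwise, since the sequences built above
   cannot be smaller than c, c starts with all the words t_k, where t_(k+1) is t_k
   followed by the successor of its reflection. This Thue-Morse structure forces
   the tails to be concatenations of four words of length 2^k |t| for every k, so
   that the dimension is 0. *)
Require Import Defs.
From mathcomp Require Import all_boot all_order all_algebra.
From mathcomp Require Import all_classical all_reals all_analysis.
From mathcomp Require Import zify ring lra.
Set Implicit Arguments.
Unset Strict Implicit.
Unset Printing Implicit Defensive.
Import Order.TTheory GRing.Theory Num.Theory.
Import numFieldNormedType.Exports.

(** * Lexicographic order and good prefixes *)

Definition lexlt (a b : nat -> nat) :=
  exists m, (forall i, i < m -> a i = b i) /\ a m < b m.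

Definition shift_seq k (a : nat -> nat) : nat -> nat := fun i => a (k + i).

Definition reflect_seq M (a : nat -> nat) : nat -> nat := fun i => M - a i.

Lemma eq_or_differ (a b : nat -> nat) :
  (forall i, a i = b i) \/
  exists m, (forall i, i < m -> a i = b i) /\ a m <> b m.
Proof.
have [|/existsNP ex] := pselect (forall i, a i = b i); first by left.
right; have ex' : exists i, a i != b i by case: ex => i /eqP; exists i.
exists (ex_minn ex'); case: ex_minnP => m /eqP neq min; split=> // i lt_im.
by apply/eqP; apply: contraTT lt_im => /min; rewrite -leqNgt.
Qed.

Lemma lexlt_total (a b : nat -> nat) :
  [\/ forall i, a i = b i, lexlt a b | lexlt b a].
Proof.
case: (eq_or_differ a b) => [|[m [eqm neqm]]]; first by constructor 1.
have [lt|lt] : a m < b m \/ b m < a m by lia.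
  by constructor 2; exists m.
by constructor 3; exists m; split=> // i /eqm.
Qed.

Lemma lexlt_trans (b a c : nat -> nat) : lexlt a b -> lexlt b c -> lexlt a c.
Proof.
move=> [m [eqm ltm]] [k [eqk ltk]]; exists (minn m k); split=> [i|].
  by rewrite leq_min => /andP[/eqm -> /eqk].
have [lt|lt|eq] := ltngtP m k; last by rewrite -eq in ltk; lia.
  by rewrite -(eqk _ lt).
by rewrite (eqm _ lt).
Qed.

Lemma lexlt_ext (a b a' b' : nat -> nat) :
  a =1 a' -> b =1 b' -> lexlt a b -> lexlt a' b'.
Proof.
move=> eqa eqb [m [eqm ltm]]; exists m; rewrite -eqa -eqb; split=> // i.
by rewrite -eqa -eqb => /eqm.
Qed.

Section Good.
Variables (M : nat) (a : nat -> nat).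
Hypothesis aM : forall i, a i <= M.

(** Each comparison is decided inside the prefix of length [n], so it persists in every sequence
    with this prefix. *)
Definition good n := forall i, 0 < i < n -> exists m,
  [/\ i + m < n, forall j, j < m -> a (i + j) = M - a j & M - a m < a (i + m)].

Hypothesis a_max : forall k, 0 < k -> ~ lexlt a (shift_seq k a).
Hypothesis a_low : forall k, 0 < k -> lexlt (reflect_seq M a) (shift_seq k a).

(* If the agreement of [shift_seq i a] with the reflection of [a] ends at position
   [e i], then [n] is good iff it lies in none of the intervals [i < n < e i].
   By maximality of [a] these intervals are nested or disjoint. *)
Lemma good_exists N : exists2 n, N <= n & good n.
Proof.
have /choice[e eP] : forall i, exists m, 0 < i ->
    [/\ forall j, j < m -> a (i + j) = M - a j & M - a m < a (i + m)].
  move=> i; have [->|i0] := posnP i; first by exists 0.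
  by have [m [eqm ltm]] := a_low i0; exists m => _; split=> // j /eqm.
(* If the agreement from [j] outlasted the one from [i], the two reflections would cancel: the shift
   of [a] by [j - i] would agree with [a] up to [d] and exceed it there, against [a_max]. *)
have nest i j : 0 < i -> i < j -> j <= i + e i -> j + e j <= i + e i.
  move=> i0 ij ji; rewrite leqNgt; apply/negP => lt.
  have [eqi lti] := eP _ i0; have [eqj ltj] := eP j (ltn_trans i0 ij).
  have [d dE] : exists d, i + e i = j + d by exists (i + e i - j); lia.
  have d_ej : d < e j by lia.
  apply: (@a_max (j - i)); first lia.
  exists d; rewrite /shift_seq; split=> [k kd|].
    have := eqj k (ltn_trans kd d_ej); have := eqi (j - i + k) ltac:(lia).
    have -> : i + (j - i + k) = j + k by lia.
    have := aM k; have := aM (j - i + k); lia.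
  have := eqj d d_ej; have := aM d; have := aM (j - i + d).
  rewrite -dE (_ : j - i + d = e i); last lia.
  lia.
have [|[i iN in_gt]] : (forall i, 0 < i < N -> i + e i < N) \/
    exists2 i, 0 < i < N & N <= i + e i.
- have [|/existsNP[i /not_implyP[iN /negP]]] :=
    pselect (forall i, 0 < i < N -> i + e i < N); first by left.
  by rewrite -leqNgt; right; exists i.
- move=> gN; exists N => // i iN; have [eqi lti] := eP i ltac:(lia).
  by exists (e i); split=> //; apply: gN.
have N0 : 0 < N by lia.
pose f (i : 'I_N) := if 0 < (i : nat) then i + e i else 0.
have [i0 fE] : {i0 | \max_i f i = f i0} by apply: bigop.eq_bigmax; rewrite card_ord.
have fmax k : 0 < k < N -> k + e k <= f i0.
  move=> /andP[k0 kN]; rewrite -fE; apply: leq_trans (leq_bigmax (Ordinal kN)).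
  by rewrite /f /= k0.
have Nf : N <= f i0 by apply: leq_trans (fmax _ iN).
(* [f i0] is the last end of an agreement that starts before [N]. Agreements that start from [N] to
   [f i0] end no later, by [nest]. *)
exists (f i0).+1 => [|j jn]; first lia.
have [eqj ltj] := eP j ltac:(lia); exists (e j); split=> //.
have [jN|Nj] := ltnP j N; first by have := fmax j; lia.
have := nest i0 j; move: Nf jn; rewrite /f.
case: ifP => [i00|_]; last lia.
have := ltn_ord i0; lia.
Qed.

End Good.

(** * Block sequences over a good prefix and the Cantor family *)

Section Blocks.
Variables (M n : nat) (a : nat -> nat).
Hypothesis aM : forall i, a i <= M.
Hypothesis a_max : forall k, 0 < k -> ~ lexlt a (shift_seq k a).
Hypothesis n_gt1 : 1 < n.
Hypothesis n_good : good M a n.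

(** Lowering precedes reflection: the block t'^- is the reflection of t^-, so its last digit is one
    more than that of t'. *)
Definition block_digit (r d : bool) o :=
  let v := a o - (d && (o.+1 == n)) in if r then M - v else v.

Definition block_seq (r d : nat -> bool) i :=
  block_digit (r (i %/ n)) (d (i %/ n)) (i %% n).

Lemma good_last : M - a 0 < a n.-1.
Proof.
have [m [mn _]] := n_good (i := n.-1) ltac:(lia).
have -> : m = 0 by lia.
by rewrite addn0.
Qed.

Lemma good_head : M - a 0 < a 0.
Proof.
apply: leq_trans good_last _; rewrite leqNgt; apply/negP => lt.
apply: (@a_max n.-1); first lia.
by exists 0; rewrite /shift_seq addn0; split.
Qed.

Lemma block_seqE r d b o : o < n ->
  block_seq r d (b * n + o) = block_digit (r b) (d b) o.
Proof.
by move=> lt_on; rewrite /block_seq divnMDl ?modnMDl ?divn_small ?modn_small ?addn0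
  //; lia.
Qed.

Lemma block_seq_leq r d i : block_seq r d i <= M.
Proof.
by rewrite /block_seq /block_digit; have := aM (i %% n); case: ifP; lia.
Qed.

Lemma reflect_block_seq r d i :
  M - block_seq r d i = block_seq (fun b => ~~ r b) d i.
Proof.
rewrite /block_seq /block_digit; have := aM (i %% n).
by case: (r _) => /=; lia.
Qed.

Lemma good_max i : 0 < i < n -> (forall j, j < n - i -> a (i + j) = a j) \/
  exists m, [/\ m < n - i, forall j, j < m -> a (i + j) = a j & a (i + m) < a m].
Proof.
move=> /andP[i0 lt_in]; have [eq|lt|[m [eqm ltm]]] := lexlt_total a (shift_seq i a).
- by left=> j _; rewrite (eq j).
- by case: (a_max i0 lt).
- have [le|gt] := leqP (n - i) m; last by right; exists m; split=> // j /eqm.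
  by left=> j jn; apply: eqm; lia.
Qed.

Section Rule.
Variables r d : nat -> bool.
Hypothesis rule : forall b, r b.+1 = if d b then r b else ~~ r b.
Let s := block_seq r d.

(** A tie with [a] can reach the end of block [b] only for the blocks t and t'^-. After both of them
    [rule] yields a reflected block, and goodness at [n - i] decides there. *)
Lemma block_seq_straddle b i : 0 < i < n -> exists m,
  [/\ m < n, forall j, j < m -> s (b * n + i + j) = a j &
      s (b * n + i + m) < a m].
Proof.
move=> i_n; have [lt0i lt_in] := andP i_n.
have sE j : j < n - i -> s (b * n + i + j) = block_digit (r b) (d b) (i + j).
  by move=> jn; rewrite -addnA /s block_seqE //; lia.
have sE' j : j < i ->
    s (b * n + i + (n - i + j)) = block_digit (r b.+1) false j.
  move=> ji; rewrite (_ : _ + _ = b.+1 * n + j); last lia.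
  rewrite /s block_seqE; last lia.
  rewrite /block_digit (_ : (j.+1 == n) = false) ?andbF //; lia.
have digE o : o.+1 < n -> forall r' d', block_digit r' d' o = if r' then M - a o else a o.
  move=> lt_on r' d'; rewrite /block_digit.
  rewrite (_ : (o.+1 == n) = false) ?andbF ?subn0 //; lia.
have [m1 [m1n eq1 lt1]] := n_good i_n.
have [m2 [m2n eq2 lt2]] := n_good (i := n - i) ltac:(lia).
have up := good_max i_n.
have straddle : (forall j, j < n - i -> s (b * n + i + j) = a j) ->
    r b.+1 -> exists m, [/\ m < n, forall j, j < m -> s (b * n + i + j) = a j &
      s (b * n + i + m) < a m].
  move=> eqs rb; exists (n - i + m2); split=> [|j jm|]; first lia.
    have [lt|ge] := ltnP j (n - i); first exact: eqs.
    rewrite (_ : j = n - i + (j - (n - i))); last lia.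
    by rewrite sE' ?digE ?rb ?eq2 //; lia.
  by rewrite sE' ?digE ?rb; have := aM m2; have := aM (n - i + m2); lia.
(* The blocks t'^-, t', t^- and t in turn. *)
move: (rule b) (sE) straddle; case: (r b); case: (d b) => rb sE1 straddle.
- have [lt|ge] := ltnP (i + m1).+1 n.
    exists m1; split=> [|j jm|]; first lia.
      by rewrite sE1 ?digE ?eq1 //; [have := aM j; lia|lia|lia].
    by rewrite sE1 ?digE; have := aM m1; have := aM (i + m1); lia.
  have m1E : i + m1 = n.-1 by lia.
  have eqs j : j < m1 -> s (b * n + i + j) = a j.
    by move=> jm; rewrite sE1 ?digE ?eq1 //; [have := aM j; lia|lia|lia].
  have sm1 : s (b * n + i + m1) <= a m1.
    by rewrite sE1 /block_digit ?m1E ?prednK ?eqxx /=; move: lt1; rewrite ?m1E; lia.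
  have [lt|ge'] := ltnP (s (b * n + i + m1)) (a m1); first by exists m1; split=> //; lia.
  apply: straddle => [j jn|]; last by rewrite rb.
  by have [jm|mj] := ltnP j m1; [exact: eqs|rewrite (_ : j = m1); lia].
- exists m1; split=> [|j jm|]; first lia.
    by rewrite sE1 ?/block_digit /= ?subn0 ?eq1 //; [have := aM j; lia|lia].
  by rewrite sE1 ?/block_digit /= ?subn0; have := aM m1; have := aM (i + m1); lia.
- have [eq|[m [mn eqm ltm]]] := up.
    have nE : i + (n - i).-1 = n.-1 by lia.
    exists (n - i).-1; split=> [|j jm|]; first lia.
      by rewrite sE1 ?digE ?eq //; lia.
    rewrite sE1 /block_digit ?nE ?prednK ?eqxx /=; try lia.
    by have := good_last; have := eq (n - i).-1; rewrite nE; lia.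
  exists m; split=> [|j jm|]; first lia.
    by rewrite sE1 ?digE ?eqm //; lia.
  by rewrite sE1 /block_digit; lia.
- have [eq|[m [mn eqm ltm]]] := up.
    apply: straddle => [j jn|]; last by rewrite rb.
    by rewrite sE1 /block_digit /= ?subn0 ?eq.
  exists m; split=> [|j jm|]; first lia.
    by rewrite sE1 /block_digit /= ?subn0 ?eqm //; lia.
  by rewrite sE1 /block_digit /= ?subn0.
Qed.

(* [c] starts like the block sequence t, t'^-, t'^-, where t' is the reflection
   of t. *)
Lemma lexlt_block_seq b (c : nat -> nat) :
  (forall j, j < 3 * n ->
     c j = block_seq (fun k => k != 0) (fun k => k != 0) j) ->
  ~~ [&& ~~ r b, ~~ d b, d b.+1 & d b.+2] ->
  lexlt (shift_seq (b * n) s) c.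
Proof.
move=> cE nd.
have cE' k o : k < 3 -> o < n -> c (k * n + o) = block_digit (k != 0) (k != 0) o.
  by move=> k3 lt_on; rewrite cE ?block_seqE //; nia.
have sE k o : o < n -> s (b * n + (k * n + o)) = block_digit (r (b + k)) (d (b + k)) o.
  by move=> lt_on; rewrite addnA -mulnDl /s block_seqE.
have agree k o : o.+1 < n -> r (b + k) = (k != 0) -> k < 3 ->
    s (b * n + (k * n + o)) = c (k * n + o).
  move=> lt_on rk k3; rewrite sE ?cE' ?rk /block_digit; try lia.
  by rewrite (_ : o.+1 == n = false) ?andbF //; lia.
have last k : r (b + k) = (k != 0) -> k < 3 -> d (b + k) = (k != 0) ->
    forall o, o < n -> s (b * n + (k * n + o)) = c (k * n + o).
  by move=> rk k3 dk o lt_on; rewrite sE ?cE' ?rk ?dk.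
have split_idx j k : j < k.+1 * n -> j < k * n \/ exists2 o, o < n & j = k * n + o.
  move=> jk; have [lt|ge] := ltnP j (k * n); first by left.
  by right; exists (j - k * n); nia.
have := good_head; have := good_last => Hl Hh.
(* The first flag [d] that deviates from those of [c] decides: in either orientation the flag of [c]
   gives the larger last digit. *)
have lt_at k : k < 3 -> r (b + k) = (k != 0) ->
    (forall k', k' < k -> r (b + k') = (k' != 0) /\ d (b + k') = (k' != 0)) ->
    (k != 0) != d (b + k) -> lexlt (shift_seq (b * n) s) c.
  move=> k3 rk prev dk; exists (k * n + n.-1); rewrite /shift_seq; split=> [j jk|].
    have [j' [ofs [k'k lt_on jE]]] : exists k' o, [/\ k' <= k, o < n & j = k' * n + o].
      by exists (j %/ n), (j %% n); rewrite -divn_eq ltn_mod; split; nia.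
    rewrite jE; have [lt|ge] := ltnP j' k.
      by have [r1 d1] := prev _ lt; apply: last => //; lia.
    have E : j' = k by lia.
    by rewrite E; apply: agree => //; move: jk; rewrite jE E; lia.
  rewrite sE ?cE' ?rk /block_digit ?prednK ?eqxx; try lia.
  by have := aM n.-1; move: dk; case: (k != 0); case: (d (b + k)) => //=; lia.
have [rb|rb] := boolP (r b).
  have e1 := sE 0 0 ltac:(lia); have e2 := cE' 0 0 isT ltac:(lia).
  rewrite !mul0n !addn0 in e1 e2; exists 0; split=> //.
  rewrite /shift_seq addn0 e1 e2 /block_digit rb.
  by rewrite (_ : 1 == n = false) ?andbF /=; lia.
have r0 : r (b + 0) = (0 != 0) by rewrite addn0 (negbTE rb).
have [db|db] := boolP (d b); first by apply: (lt_at 0) => //; rewrite addn0 db.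
have d0 : d (b + 0) = (0 != 0) by rewrite addn0 (negbTE db).
have r1 : r (b + 1) = (1 != 0) by rewrite addn1 rule (negbTE db) rb.
have [db1|db1] := boolP (d b.+1); last first.
  apply: (lt_at 1) => [|//|[]//|]; first by [].
  by rewrite addn1 (negbTE db1).
have d1 : d (b + 1) = (1 != 0) by rewrite addn1 db1.
have r2 : r (b + 2) = (2 != 0) by rewrite addn2 rule db1 -addn1.
apply: (lt_at 2) => [|//|[|[|]]//|]; first by [].
by move: nd; rewrite rb db db1 addn2 /= => /negbTE ->.
Qed.

End Rule.

Fixpoint block_refl (d : nat -> bool) b :=
  if b is b'.+1 then (if d b' then block_refl d b' else ~~ block_refl d b')
  else false.

(* With t' the reflection of t: the four blocks t t'^- t'^- t' come first, then
   each bit of [w] selects t t' t t' or t t'^- t' t^-. *)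
Definition family_dec (w : nat -> bool) b :=
  if b < 4 then (b == 1) || (b == 2) else w (b %/ 4).-1 && odd b.

Definition block_family w := block_seq (block_refl (family_dec w)) (family_dec w).

(** Every group of four blocks has an even number of unlowered blocks, and exactly these reverse the
    orientation. *)
Lemma block_refl_family w k : block_refl (family_dec w) (4 * k) = false.
Proof.
elim: k => [//|k IH]; have [->//|k0] := posnP k.
have decE j : j < 4 -> family_dec w (4 * k + j) = w k.-1 && odd j.
  move=> j4; rewrite /family_dec (_ : (4 * k + j < 4) = false); last lia.
  rewrite (_ : (4 * k + j) %/ 4 = k); last lia.
  by rewrite (_ : odd (4 * k + j) = odd j); last lia.
rewrite (_ : 4 * k.+1 = (4 * k).+4) /=; last lia.
have := (decE 0 isT, decE 1 isT, decE 2 isT, decE 3 isT).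
rewrite /= andbF addn0 addn1 addn2 addn3 => -[[[d0 d1] d2] d3].
rewrite IH d0 d1 d2 d3 /= !andbT.
by case: (w _).
Qed.

Lemma family_start w b : b < 3 ->
  block_refl (family_dec w) b = (b != 0) /\ family_dec w b = (b != 0).
Proof. by case: b => [|[|[|]]]. Qed.

Lemma familyE w j : j < 3 * n ->
  block_family w j = block_seq (fun k => k != 0) (fun k => k != 0) j.
Proof.
move=> jn; have [|rE dE] := @family_start w (j %/ n).
  by rewrite ltn_divLR //; lia.
by rewrite /block_family /block_seq rE dE.
Qed.

Lemma family_prefix w j : j < n -> block_family w j = a j.
Proof.
move=> jn; rewrite familyE; last lia.
by rewrite /block_seq divn_small // modn_small // /block_digit /= subn0.
Qed.

Lemma family_second w j : j < n ->
  block_family w (n + j) = M - (a j - (j.+1 == n)).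
Proof.
move=> jn; rewrite familyE; last lia.
by rewrite -{1}(mul1n n) block_seqE.
Qed.

(** Two adjacent lowered blocks occur only at indices 1 and 2. This makes the opening of the family
    unique, so that no later shift can tie with it. *)
Lemma family_no_pattern w b : 0 < b ->
  ~~ [&& ~~ family_dec w b, family_dec w b.+1 & family_dec w b.+2].
Proof.
case: b => [|[|[|b]]] // _; try by rewrite /family_dec /= ?andbF.
have decE m : family_dec w m.+4 = w (m.+4 %/ 4).-1 && odd m.
  by rewrite /family_dec /= !negbK.
by rewrite !decE /=; case: (odd b); rewrite /= ?andbF ?andbT ?andbF.
Qed.

Lemma lexlt_family w r k :
  (forall b, r b.+1 = if family_dec w b then r b else ~~ r b) ->
  (r 0 \/ 0 < k) ->
  lexlt (shift_seq k (block_seq r (family_dec w))) (block_family w).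
Proof.
move=> rule rk; have n0 : 0 < n by lia.
have := divn_eq k n; have := ltn_pmod k n0.
move: (k %/ n) (k %% n) => b i lt_in kE; rewrite kE in rk *.
have [i_eq0|i0] := posnP i.
  rewrite i_eq0 addn0 in rk *; apply: lexlt_block_seq => // [j|]; first exact: familyE.
  have [b0|b0] := posnP b; last first.
    by have := family_no_pattern w b0; rewrite !negb_and => ->; rewrite orbT.
  by move: rk; rewrite b0 => -[->|].
have [m [mn eqm ltm]] := block_seq_straddle rule b (i := i) ltac:(lia).
exists m; split=> [j jm|]; last by rewrite family_prefix.
by rewrite family_prefix -?eqm //; lia.
Qed.

Lemma family_shift w k : 0 < k -> lexlt (shift_seq k (block_family w)) (block_family w).
Proof. by move=> k0; apply: lexlt_family => //; right. Qed.

Lemma family_reflect w k :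
  lexlt (reflect_seq M (shift_seq k (block_family w))) (block_family w).
Proof.
apply: (@lexlt_ext (shift_seq k (block_seq
  (fun b => ~~ block_refl (family_dec w) b) (family_dec w))) (block_family w)) => //.
  by move=> i; rewrite /reflect_seq /shift_seq reflect_block_seq.
apply: lexlt_family => [b|]; last by left.
by rewrite /=; case: ifP.
Qed.

Lemma family_leq w i : block_family w i <= M.
Proof. exact: block_seq_leq. Qed.

(** Bit [k] governs the blocks from [4 * k + 4] to [4 * k + 7]. It first matters in the last digit
    of block [4 * k + 5], which is t' for [w] and t'^- for [w']. The positive digit opens block
    [4 * k + 7] of [w']; it will keep the values a definite amount apart. *)
Lemma family_separation w w' k : (forall i, i < k -> w i = w' i) ->
  w k = false -> w' k ->
  let m := ((4 * k + 5) * n + n.-1) in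
  [/\ forall i, i < m -> block_family w i = block_family w' i,
      block_family w' m = (block_family w m).+1 & 0 < block_family w' (m.+1 + n)].
Proof.
move=> eqw wk w'k m.
have decE b : b < 4 * k + 5 -> family_dec w b = family_dec w' b.
  move=> bk; rewrite /family_dec; case: ifP => // b4.
  have [lt|ge] := ltnP (b %/ 4).-1 k; first by rewrite eqw.
  by rewrite (_ : odd b = false) ?andbF //; lia.
have reflE b : b <= 4 * k + 5 ->
    block_refl (family_dec w) b = block_refl (family_dec w') b.
  elim: b => [//|b IH bk] /=; rewrite decE; last lia.
  by rewrite IH //; lia.
have dec_w' b : 4 <= b -> (b %/ 4).-1 = k -> family_dec w' b = odd b.
  by move=> b4 bE; rewrite /family_dec ltnNge b4 /= bE w'k.
have dec5 : family_dec w (4 * k + 5) = false.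
  rewrite /family_dec (_ : (4 * k + 5 < 4) = false); last lia.
  by rewrite (_ : (4 * k + 5) %/ 4 = k.+1) ?wk //; lia.
have refl4 := block_refl_family w' k.+1.
have reflS d b : block_refl d b.+1 = if d b then block_refl d b else ~~ block_refl d b.
  by [].
have refl5 : block_refl (family_dec w') (4 * k + 5).
  rewrite (_ : 4 * k + 5 = (4 * k.+1).+1); last lia.
  by rewrite reflS refl4 dec_w'; [case: ifP => //; lia|lia|lia].
have refl6 : block_refl (family_dec w') (4 * k + 6).
  rewrite (_ : 4 * k + 6 = (4 * k + 5).+1); last lia.
  by rewrite reflS dec_w' ?refl5; [case: ifP => //; lia|lia|lia].
have refl7 : block_refl (family_dec w') (4 * k + 7) = false.
  rewrite (_ : 4 * k + 7 = (4 * k + 6).+1); last lia.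
  by rewrite reflS dec_w' ?refl6; [case: ifP => //; lia|lia|lia].
have n0 : 0 < n by lia.
split=> [i im||].
- rewrite /block_family {1}(divn_eq i n) {3}(divn_eq i n).
  have := ltn_pmod i n0; have := divn_eq i n.
  move: (i %/ n) (i %% n) => b o iE lt_on; rewrite !block_seqE //.
  have b5 : b <= 4 * k + 5 by rewrite /m in im; nia.
  rewrite reflE // /block_digit.
  have [lt|ge] := ltnP b (4 * k + 5); first by rewrite decE.
  by rewrite (_ : o.+1 == n = false) ?andbF //; rewrite /m in im; nia.
- rewrite /block_family !block_seqE; try lia.
  rewrite /block_digit reflE // refl5 dec5 dec_w'; try lia.
  have -> : odd (4 * k + 5) by lia.
  rewrite prednK // eqxx /=; have := good_last; have := aM n.-1; lia.
- rewrite (_ : m.+1 + n = (4 * k + 7) * n + 0); last by rewrite /m; nia.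
  rewrite /block_family block_seqE // /block_digit refl7.
  by rewrite (_ : 1 == n = false) ?andbF; [have := good_head; lia|lia].
Qed.

(** By [a_low] the second block of [a] exceeds t' somewhere. If it did so before the last digit, or
    there by more than 1, the family, which starts with t t'^-, would be smaller than [a]. *)
Lemma good_double w :
  (forall k, 0 < k -> lexlt (reflect_seq M a) (shift_seq k a)) ->
  ~ lexlt (block_family w) a ->
  [/\ forall j, j.+1 < n -> a (n + j) = M - a j,
      a (n + n.-1) = (M - a n.-1).+1 & good M a (n + n)].
Proof.
move=> a_low fam_a; have Hl := good_last.
have [m [eqm ltm]] := a_low n ltac:(lia); rewrite /reflect_seq /shift_seq in eqm ltm.
(* If the agreement with the reflection covered the whole second block, reflecting twice would make
   the shift by [n + n] exceed [a]. *)
have mn : m < n.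
  rewrite ltnNge; apply/negP => nm; apply: (@a_max (n + n)); first lia.
  exists (m - n); rewrite /shift_seq; split=> [j jm|].
    have := eqm (n + j) ltac:(lia); have := eqm j ltac:(lia).
    by rewrite addnA; have := aM j; lia.
  have := eqm (m - n) ltac:(lia); move: ltm.
  rewrite (_ : n + n + (m - n) = n + m); last lia.
  rewrite (_ : n + (m - n) = m); last lia.
  by have := aM (m - n); lia.
have fam_eq i : i < n + m -> block_family w i = a i.
  move=> im; have [lt|ge] := ltnP i n; first exact: family_prefix.
  have [u uE] : exists o, i = n + o by exists (i - n); lia.
  rewrite uE family_second; last lia.
  rewrite (_ : (u.+1 == n) = false); last lia.
  by rewrite subn0 eqm //; lia.
have mE : m = n.-1.
  apply/eqP; rewrite eqn_leq; apply/andP; split; first lia.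
  rewrite leqNgt; apply/negP => lt; apply: fam_a; exists (n + m); split=> //.
  by rewrite family_second // (_ : (m.+1 == n) = false) ?subn0 //; lia.
have eqa j : j.+1 < n -> a (n + j) = M - a j by move=> jn; rewrite -eqm //; lia.
have last_eq : a (n + n.-1) = (M - a n.-1).+1.
  apply/eqP; rewrite eqn_leq -{4}mE -{3}mE ltm andbT leqNgt; apply/negP => lt.
  apply: fam_a; exists (n + m); split=> //; rewrite mE family_second; last lia.
  by rewrite prednK ?eqxx /=; have := aM n.-1; lia.
split=> // i i2n; have [lt|gt|->] := ltngtP i n.
- have [m' [im eqm' ltm']] := n_good (i := i) ltac:(lia).
  by exists m'; split=> //; lia.
(* Such a suffix is a reflected suffix of t with its last digit raised. Suffixes of t are at most
   the prefixes of t, and the raised digit makes the inequality strict in case of equality. *)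
- have [eq|[m' [m'n eqm' ltm']]] := good_max (i := i - n) ltac:(lia).
    exists (n.-1 - (i - n)); split=> [|j jm|]; first lia.
      have := eqa (i - n + j) ltac:(lia); have := eq j ltac:(lia).
      by rewrite (_ : n + (i - n + j) = i + j); [move=> -> ->|lia].
    have := eq (n.-1 - (i - n)) ltac:(lia); have := aM n.-1.
    rewrite (_ : i - n + (n.-1 - (i - n)) = n.-1); last lia.
    by rewrite (_ : i + (n.-1 - (i - n)) = n + n.-1); lia.
  exists m'; split=> [|j jm|]; first lia.
    have := eqa (i - n + j) ltac:(lia); rewrite eqm' //.
    by rewrite (_ : n + (i - n + j) = i + j); [move=> ->|lia].
  have E : i + m' = n + (i - n + m') by lia.
  have := aM m'; have [lt2|eq2] : (i - n + m').+1 < n \/ i - n + m' = n.-1 by lia.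
    by rewrite E eqa //; lia.
  by rewrite E eq2 last_eq -eq2; lia.
- by exists m; split=> [|j /eqm ->|//]; first lia.
Qed.

End Blocks.

(** * Thue-Morse block structure *)

Definition dominated M lam (y : nat -> nat) :=
  (forall i, y i <= M) /\
  forall k, lexlt (shift_seq k y) lam /\ lexlt (reflect_seq M (shift_seq k y)) lam.

Lemma dominated_shift M lam y k :
  dominated M lam y -> dominated M lam (shift_seq k y).
Proof.
move=> [yM y_dom]; split=> [i|j]; first exact: yM.
have [lt1 lt2] := y_dom (k + j).
split; [apply: lexlt_ext lt1|apply: lexlt_ext lt2] => // i;
  by rewrite /reflect_seq /shift_seq addnA.
Qed.

Lemma dominated_reflect M lam y :
  dominated M lam y -> dominated M lam (reflect_seq M y).
Proof.
move=> [yM y_dom]; split=> [i|j]; first exact: leq_subr.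
have [lt1 lt2] := y_dom j; split; first exact: lt2.
by apply: lexlt_ext lt1 => // i; rewrite /reflect_seq /shift_seq subKn.
Qed.

Section ThueMorse.
Variables (M n : nat) (lam : nat -> nat).
Hypothesis lamM : forall i, lam i <= M.
Hypothesis n_gt1 : 1 < n.
Let N k := 2 ^ k * n.
(* [lam] starts with t_k for every k, where t_0 has length n and t_(k+1) is
   t_k followed by the successor of its reflection. *)
Hypothesis lam_double : forall k,
  (forall j, j.+1 < N k -> lam (N k + j) = M - lam j) /\
  lam (N k + (N k).-1) = (M - lam (N k).-1).+1.

Let N_gt1 k : 1 < N k.
Proof. by rewrite /N; have := expn_gt0 2 k; nia. Qed.

Let N_double k : N k.+1 = N k + N k.
Proof. by rewrite /N expnS; lia. Qed.

Definition starts_with k (y : nat -> nat) := forall j, j < N k -> y j = lam j.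

(** After t_k, the bound on [y] limits the next block from above by the second half of t_(k+1), and
    the bound on the reflected tail limits it from below by the reflection of t_k. These two words
    differ by 1 in the last digit only. *)
Lemma starts_with_next k y : dominated M lam y -> starts_with k y ->
  starts_with k (reflect_seq M (shift_seq (N k) y)) \/ starts_with k.+1 y.
Proof.
move=> [yM y_dom] yk; have [lam1 lam2] := lam_double k.
have [[m [eqm ltm]] _] := y_dom 0; have [_ [m' [eqm' ltm']]] := y_dom (N k).
have N1 := N_gt1 k; rewrite /shift_seq in eqm ltm; rewrite /reflect_seq /shift_seq in eqm' ltm'.
have mN : N k <= m.
  by rewrite leqNgt; apply/negP => /yk; rewrite add0n in ltm; lia.
have m'N : (N k).-1 <= m'.
  rewrite leqNgt; apply/negP => lt.
  have := lam1 m' ltac:(lia); have := lamM m'; have := yM (N k + m') => h1 h2 h3.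
  have [lt1|lt1|eq] := ltngtP m (N k + m').
  - have := lam1 (m - N k) ltac:(lia); have := eqm' (m - N k) ltac:(lia).
    have -> : N k + (m - N k) = m by lia.
    by have := yM m; rewrite add0n in ltm; lia.
  - by have := eqm _ lt1; rewrite add0n; lia.
  - by move: ltm; rewrite add0n eq; lia.
have eqr j : j.+1 < N k -> M - y (N k + j) = lam j by move=> ?; apply: eqm'; lia.
have last_le : y (N k + (N k).-1) <= lam (N k + (N k).-1).
  have [lt1|lt1|eq] := ltngtP m (N k + (N k).-1).
  - have := lam1 (m - N k) ltac:(lia); have := eqr (m - N k) ltac:(lia).
    have -> : N k + (m - N k) = m by lia.
    by have := yM m; rewrite add0n in ltm; lia.
  - by have := eqm _ lt1; rewrite add0n; lia.
  - by move: ltm; rewrite add0n eq; lia.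
have last_ge : M - y (N k + (N k).-1) <= lam (N k).-1.
  have [lt1|eq] : (N k).-1 < m' \/ (N k).-1 = m' by lia.
    by rewrite eqm'.
  by rewrite eq; lia.
have := yM (N k + (N k).-1); have := lamM (N k).-1 => h1 h2.
have [eq|eq] : y (N k + (N k).-1) = M - lam (N k).-1 \/
    y (N k + (N k).-1) = lam (N k + (N k).-1) by lia.
  left=> j jN; rewrite /reflect_seq /shift_seq.
  by have [lt|eq'] : j.+1 < N k \/ j = (N k).-1; [lia|exact: eqr|rewrite eq' eq; lia].
right=> j; rewrite N_double => jN; have [lt|ge] := ltnP j (N k); first exact: yk.
have -> : j = N k + (j - N k) by lia.
have [lt|eq'] : (j - N k).+1 < N k \/ j - N k = (N k).-1 by lia.
  by have := eqr _ lt; rewrite lam1 //; have := yM (N k + (j - N k)); lia.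
by rewrite eq' eq.
Qed.

(** The block after t_(k+1) is its reflection, possibly with the last digit raised; the first half
    is the reflection of t_k in both cases. *)
Lemma starts_with_skip k y : dominated M lam y -> starts_with k.+1 y ->
  starts_with k (reflect_seq M (shift_seq (N k.+1) y)).
Proof.
move=> ydom yk; have := N_double k; have := N_gt1 k => N1 NE.
have [yr j jN|yk2 j jN] := starts_with_next ydom yk; first by apply: yr; lia.
have [lam1 _] := lam_double k.+1; rewrite /reflect_seq /shift_seq yk2.
  by rewrite lam1; have := lamM j; lia.
by rewrite (N_double k.+1); lia.
Qed.

Definition synchronized k y :=
  starts_with k y \/ starts_with k (reflect_seq M y).

Lemma synchronized_next k y : dominated M lam y -> synchronized k y ->
  synchronized k (shift_seq (N k) y) \/
  synchronized k.+1 y /\ synchronized k (shift_seq (N k.+1) y).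
Proof.
move=> ydom [yk|yk].
  have [yr|yk1] := starts_with_next ydom yk; first by left; right.
  by right; split; [left|right; exact: starts_with_skip].
have rdom := dominated_reflect ydom; have [yM _] := ydom.
have rK i : reflect_seq M (shift_seq i (reflect_seq M y)) =1 shift_seq i y.
  by move=> j; rewrite /reflect_seq /shift_seq subKn.
have [yr|yk1] := starts_with_next rdom yk.
  by left; left=> j jN; rewrite -rK yr.
right; split; first by right.
by left=> j jN; rewrite -rK (starts_with_skip rdom yk1).
Qed.

(* The block at a synchronized position is t_k or its reflection; the other two
   possible blocks differ from these in the last digit. *)
Definition tm_blocks k : seq (seq nat) :=
  [:: mkseq lam (N k); mkseq (fun j => M - lam j) (N k);
      mkseq (fun j => lam (N k + j)) (N k);
      mkseq (fun j => M - lam (N k + j)) (N k)].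

Definition block_decomposition L (bs : seq (seq nat)) (y : nat -> nat) :=
  forall j, exists2 b, b \in bs & forall o, o < L -> y (j * L + o) = nth 0 b o.

(** A multiple of [N k] that is not synchronized falls in the middle of t_(k+1) or its reflection,
    and then the next multiple is synchronized. *)
Lemma synchronized_blocks k y : dominated M lam y -> synchronized k y ->
  block_decomposition (N k) (tm_blocks k) y.
Proof.
move=> ydom y0; have [yM _] := ydom.
have inv j : synchronized k (shift_seq (j * N k) y) \/
    [/\ exists2 b, b \in tm_blocks k &
          forall o, o < N k -> y (j * N k + o) = nth 0 b o
      & synchronized k (shift_seq (j.+1 * N k) y)].
  elim: j => [|j [yj|[_ yj]]]; [by left| |by left].
  have [] := synchronized_next (dominated_shift (j * N k) ydom) yj.
    move=> h; left; have -> // : shift_seq (j.+1 * N k) y = shift_seq (N k) (shift_seq (j * N k) y).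
    by apply/funext => i; rewrite /shift_seq mulSn; congr y; lia.
  move=> [[yk1|yk1] h]; right; split.
  - exists (mkseq (fun j => lam (N k + j)) (N k)); first by rewrite !inE eqxx ?orbT.
    move=> o lt_on; rewrite nth_mkseq // -yk1 /shift_seq ?N_double; last lia.
    by congr y; lia.
  - have -> // : shift_seq (j.+2 * N k) y = shift_seq (N k.+1) (shift_seq (j * N k) y).
    by apply/funext => i; rewrite /shift_seq N_double; congr y; lia.
  - exists (mkseq (fun j => M - lam (N k + j)) (N k)); first by rewrite !inE eqxx ?orbT.
    move=> o lt_on; rewrite nth_mkseq // -yk1 /reflect_seq /shift_seq ?N_double; last lia.
    by rewrite subKn //; congr y; lia.
  - have -> // : shift_seq (j.+2 * N k) y = shift_seq (N k.+1) (shift_seq (j * N k) y).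
    by apply/funext => i; rewrite /shift_seq N_double; congr y; lia.
move=> j; have [[yj|yj]|[//]] := inv j.
  exists (mkseq lam (N k)); first by rewrite !inE eqxx.
  by move=> o lt_on; rewrite nth_mkseq // -yj.
exists (mkseq (fun j => M - lam j) (N k)); first by rewrite !inE eqxx ?orbT.
by move=> o lt_on; rewrite nth_mkseq // -yj // /reflect_seq /shift_seq subKn.
Qed.

(** If t_(k+1) and its reflection never occur, only the first alternative of [starts_with_next]
    remains: t_k and its reflection alternate forever. *)
Lemma unsynchronized_antiperiodic k y : dominated M lam y -> synchronized k y ->
  (forall m, ~ synchronized k.+1 (shift_seq m y)) ->
  forall i, y (N k + i) = M - y i.
Proof.
move=> ydom y0 yk1; have [yM _] := ydom.
have sync j : synchronized k (shift_seq (j * N k) y).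
  elim: j => [//|j yj].
  have [h|[h _]] := synchronized_next (dominated_shift (j * N k) ydom) yj.
    have -> // : shift_seq (j.+1 * N k) y = shift_seq (N k) (shift_seq (j * N k) y).
    by apply/funext => i; rewrite /shift_seq mulSn; congr y; lia.
  by have := yk1 _ h.
have N1 := N_gt1 k.
move=> i; rewrite (divn_eq i (N k)); have := ltn_pmod i (ltnW N1).
move: (i %/ N k) (i %% N k) => j o oN; rewrite addnA -mulSn.
have sj := dominated_shift (j * N k) ydom.
have sE : shift_seq (j.+1 * N k) y = shift_seq (N k) (shift_seq (j * N k) y).
  by apply/funext => i'; rewrite /shift_seq mulSn; congr y; lia.
have rK i' : reflect_seq M (shift_seq i' (reflect_seq M (shift_seq (j * N k) y))) =1
    shift_seq i' (shift_seq (j * N k) y).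
  by move=> j'; rewrite /reflect_seq /shift_seq subKn.
have not1 := yk1 (j * N k).
case: (sync j) => yj.
  have [yr|h] := starts_with_next sj yj; last by case: not1; left.
  have := yr o oN; have := yj o oN; rewrite /reflect_seq -sE /shift_seq => -> <-.
  by rewrite subKn.
have [yr|h] := starts_with_next (dominated_reflect sj) yj; last by case: not1; right.
have := yr o oN; have := yj o oN; rewrite rK -sE {1}/reflect_seq /shift_seq => -> <- //.
Qed.

(** Either level [k] is reached in some tail, or the tails get stuck at a level [k' < k]. Then a
    tail has period [2 * N k'], which divides [N k]. *)
Lemma eventually_blocks k y : dominated M lam y -> starts_with 0 y ->
  exists m bs, size bs = 4 /\ block_decomposition (N k) bs (shift_seq m y).
Proof.
move=> ydom y0.
have [[m ym]|[k' [m [k'k ym yn]]]] : (exists m, synchronized k (shift_seq m y)) \/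
    exists k' m, [/\ k' < k, synchronized k' (shift_seq m y) &
      forall m', ~ synchronized k'.+1 (shift_seq m' (shift_seq m y))].
- elim: k => [|k [[m ym]|[k' [m [k'k ym yn]]]]].
  + by left; exists 0; left.
  + have [[m' h]|h] := pselect (exists m', synchronized k.+1 (shift_seq m' (shift_seq m y))).
      left; exists (m + m'); have -> // : shift_seq (m + m') y = shift_seq m' (shift_seq m y).
      by apply/funext => i; rewrite /shift_seq addnA.
    right; exists k, m; split=> // m' h'; apply: h; by exists m'.
  + by right; exists k', m; split=> //; lia.
- exists m, (tm_blocks k); split=> //.
  by apply: synchronized_blocks => //; exact: dominated_shift.
have ydom' := dominated_shift m ydom; have [yM _] := ydom'.
have anti := unsynchronized_antiperiodic ydom' ym yn.
set z := shift_seq m y in anti yM.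
have [c cE] : exists c, N k = c * (N k' + N k').
  exists (2 ^ (k - k'.+1)); rewrite -N_double /N mulnA -expnD.
  by congr (2 ^ _ * _); lia.
have per i : z (N k' + N k' + i) = z i.
  by rewrite -addnA !anti subKn.
have perm c' i : z (c' * (N k' + N k') + i) = z i.
  by elim: c' => [//|c' IH]; rewrite mulSn -addnA per.
(* A single word suffices; repeating it gives the list its required length. *)
exists m, (nseq 4 (mkseq z (N k))); split=> // j.
exists (mkseq z (N k)); first by rewrite mem_nseq eqxx.
move=> o oN; rewrite nth_mkseq // -/z.
rewrite (_ : j * N k = j * c * (N k' + N k')); first by rewrite perm.
by rewrite -mulnA -cE.
Qed.

End ThueMorse.

Local Open Scope classical_set_scope.
Local Open Scope ring_scope.

(** * Values of digit sequences *)

Section Values.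
Variables (R : realType) (M : nat).
Implicit Types (q p : R) (d e : nat -> nat).

Definition digit_seq d := forall i, (d i <= M)%N.

Definition value q d : R := limn (series (fun i => (d i)%:R * q ^- i.+1)).

Definition partial_value q d m : R := \sum_(i < m) (d i)%:R * q ^- i.+1.

Lemma digit_shift (k : nat) d : digit_seq d -> digit_seq (shift_seq k d).
Proof. by move=> dM i; exact: dM. Qed.

Lemma digit_reflect d : digit_seq (reflect_seq M d).
Proof. by move=> i; exact: leq_subr. Qed.

Lemma value_ext q d e : d =1 e -> value q d = value q e.
Proof. by move=> /funext ->. Qed.

Lemma shift_add i j d : shift_seq i (shift_seq j d) = shift_seq (j + i) d.
Proof. by apply/funext => k; rewrite /shift_seq addnA. Qed.

Lemma partial_value_ext q d e m : (forall i, (i < m)%N -> d i = e i) ->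
  partial_value q d m = partial_value q e m.
Proof. by move=> eq; apply: eq_bigr => i _; rewrite eq. Qed.

Lemma is_cvg_value q d : 1 < q -> digit_seq d ->
  cvgn (series (fun i => (d i)%:R * q ^- i.+1 : R)).
Proof.
move=> q1 dM; have q0 : 0 < q by lra.
have q_inv : `|q^-1| < 1 by rewrite gtr0_norm ?invr_gt0 // invf_lt1.
apply: (series_le_cvg (v_ := geometric (M%:R * q^-1) q^-1)).
- by move=> i; rewrite mulr_ge0 // invr_ge0 exprn_ge0 // ltW.
- by move=> i /=; rewrite !mulr_ge0 ?exprn_ge0 ?invr_ge0 // ltW.
- move=> i /=; rewrite -mulrA -exprS exprVn ler_wpM2r ?ler_nat //.
  by rewrite invr_ge0 exprn_ge0 // ltW.
- exact: is_cvg_geometric_series.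
Qed.

(** By telescoping the partial sums are [r 0 - q ^- m * r m], and a bounded [r] makes the last term
    vanish. *)
Lemma value_remainder q d (r : nat -> R) B : 1 < q ->
  (forall i, `|r i| <= B) -> (forall i, q * r i = (d i)%:R + r i.+1) ->
  value q d = r 0%N.
Proof.
move=> q1 rB rE; have q0 : 0 < q by lra.
have partialE m : series (fun i => (d i)%:R * q ^- i.+1) m = r 0%N - q ^- m * r m.
  rewrite /series /= big_mkord; elim: m => [|m IH].
    by rewrite big_ord0 expr0 invr1 mul1r subrr.
  rewrite big_ord_recr /= IH exprS invfM.
  have -> : (d m)%:R = q * r m - r m.+1 by rewrite rE addrK.
  by field; rewrite expf_neq0 gt_eqF.
apply/cvg_lim => //; rewrite (_ : series _ = (fun m => r 0%N - q ^- m * r m)).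
  rewrite -[X in _ --> X]subr0; apply: cvgB; first exact: cvg_cst.
  apply/norm_cvg0P/(@squeeze_cvgr _ _ _ _ (fun=> 0) (fun m => B * q^-1 ^+ m)).
  - apply: nearW => m /=; rewrite normr_ge0 /= normrM mulrC exprVn.
    rewrite (ger0_norm (x := q ^- m)) ?ler_wpM2r ?invr_ge0 ?exprn_ge0 //; exact: ltW.
  - exact: cvg_cst.
  - rewrite -(mulr0 B); apply: cvgM; first exact: cvg_cst.
    apply: cvg_expr.
    by rewrite gtr0_norm ?invr_gt0 // invf_lt1.
by apply/funext.
Qed.

Lemma value_cst q : 1 < q -> value q (fun=> M) = M%:R / (q - 1).
Proof.
move=> q1; apply: (value_remainder (r := fun=> M%:R / (q - 1)) q1) => // i.
by field; rewrite subr_eq0 gt_eqF.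
Qed.

Lemma value_le q d e : 1 < q -> digit_seq d -> digit_seq e ->
  (forall i, (d i <= e i)%N) -> value q d <= value q e.
Proof.
move=> q1 dM eM le; apply: lim_series_le; [exact: is_cvg_value..|] => i.
by rewrite ler_wpM2r ?ler_nat // invr_ge0 exprn_ge0 // ltW //; lra.
Qed.

Lemma partial_value_ge0 q d m : 0 < q -> 0 <= partial_value q d m.
Proof.
move=> q0; apply: sumr_ge0 => i _.
by rewrite mulr_ge0 // invr_ge0 exprn_ge0 // ltW.
Qed.

Lemma partial_value_le q d m : 1 < q -> digit_seq d ->
  partial_value q d m <= value q d.
Proof.
move=> q1 dM; have q0 : 0 < q by lra.
have -> : partial_value q d m = series (fun i => (d i)%:R * q ^- i.+1) m.
  by rewrite /series /= big_mkord.
apply: (nondecreasing_cvgn_le _ (is_cvg_value q1 dM)).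
apply: nondecreasing_series => i _ _.
by rewrite mulr_ge0 // invr_ge0 exprn_ge0 // ltW.
Qed.

Lemma value_ge0 q d : 1 < q -> digit_seq d -> 0 <= value q d.
Proof.
by move=> q1 dM; have := partial_value_le 0 q1 dM; rewrite /partial_value big_ord0.
Qed.

Lemma value_le_max q d : 1 < q -> digit_seq d -> value q d <= M%:R / (q - 1).
Proof. by move=> q1 dM; rewrite -value_cst //; apply: value_le. Qed.

Lemma value_rec q d : 1 < q -> digit_seq d ->
  q * value q d = (d 0)%:R + value q (shift_seq 1 d).
Proof.
move=> q1 dM; have q0 : q != 0 by rewrite gt_eqF //; lra.
have [cd cs] := (is_cvg_value q1 dM, is_cvg_value q1 (digit_shift 1 dM)).
suff -> : value q d = q^-1 * ((d 0)%:R + value q (shift_seq 1 d)).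
  by rewrite mulVKf.
apply/cvg_lim => //; rewrite -cvg_shiftS /=.
rewrite (_ : (fun n => _) = (fun n => q^-1 * ((d 0)%:R +
    series (fun i => (shift_seq 1 d i)%:R * q ^- i.+1) n))).
  by apply: cvgM; [exact: cvg_cst|]; apply: cvgD; [exact: cvg_cst|exact: cs].
apply/funext => n; rewrite /series /= !big_mkord big_ord_recl /= mulrDr expr1.
rewrite [in LHS]mulrC; congr (_ + _); rewrite mulr_sumr; apply: eq_bigr => i _.
by rewrite /shift_seq /= /bump /= add1n [q ^+ i.+2]exprS invfM mulrCA.
Qed.

Lemma value_split q d m : 1 < q -> digit_seq d ->
  value q d = partial_value q d m + q ^- m * value q (shift_seq m d).
Proof.
move=> q1 dM; have q0 : q != 0 by rewrite gt_eqF //; lra.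
elim: m => [|m IH]; first by rewrite /partial_value big_ord0 expr0 invr1 mul1r add0r.
rewrite IH /partial_value big_ord_recr /= -addrA; congr (_ + _).
have := value_rec q1 (digit_shift m dM).
rewrite shift_add addn1 {2}/shift_seq addn0 => vE.
have -> : value q (shift_seq m d) = q^-1 * ((d m)%:R + value q (shift_seq m.+1 d)).
  by rewrite -vE mulKf.
by rewrite exprS; field; rewrite q0 expf_neq0.
Qed.

Lemma value_ge_digit q d i : 1 < q -> digit_seq d -> (0 < d i)%N ->
  q ^- i.+1 <= value q d.
Proof.
move=> q1 dM di; have q0 : 0 < q by lra.
apply: le_trans (partial_value_le i.+1 q1 dM).
rewrite /partial_value big_ord_recr /=.
have := partial_value_ge0 d i q0; rewrite /partial_value.
have : q ^- i.+1 <= (d i)%:R * q ^- i.+1.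
  by rewrite ler_peMl ?ler1n // invr_ge0 exprn_ge0 // ltW.
lra.
Qed.

Lemma value_gt0 q d i : 1 < q -> digit_seq d -> (0 < d i)%N -> 0 < value q d.
Proof.
move=> q1 dM /(value_ge_digit q1 dM); apply: lt_le_trans.
by rewrite invr_gt0 exprn_gt0 //; lra.
Qed.

Lemma value_reflect q d : 1 < q -> digit_seq d ->
  value q (reflect_seq M d) = M%:R / (q - 1) - value q d.
Proof.
move=> q1 dM; rewrite -value_cst // /value -lim_seriesB; try exact: is_cvg_value.
congr (limn (series _)); apply/funext => i /=.
by rewrite /GRing.add /= /GRing.opp /= /reflect_seq natrB // mulrBl.
Qed.

(* Each term shrinks at least by the factor [p / q]. *)
Lemma value_base_ratio p q d : 1 < p -> p <= q -> digit_seq d ->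
  value q d <= p / q * value p d.
Proof.
move=> p1 pq dM; have p0 : 0 < p by lra.
have q0 : 0 < q by lra.
have c := is_cvg_value p1 dM.
rewrite -[leRHS](lim_seriesZ (p / q : R) c).
apply: lim_series_le; [by apply: is_cvg_value => //; lra|exact: is_cvg_seriesZ|].
move=> i; rewrite [leRHS](_ : _ = p / q * ((d i)%:R * p ^- i.+1)) //.
rewrite mulrCA ler_wpM2l //.
rewrite !exprS !invfM mulrACA divff ?gt_eqF // mul1r.
rewrite ler_wpM2l ?invr_ge0 ?(ltW q0) // lef_pV2 ?posrE ?exprn_gt0 //.
by rewrite lerXn2r // nnegrE ltW.
Qed.

Lemma value_base_le p q d : 1 < p -> p <= q -> digit_seq d ->
  value q d <= value p d.
Proof.
move=> p1 pq dM; apply: le_trans (value_base_ratio p1 pq dM) _.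
by rewrite ler_piMl ?value_ge0 // ler_pdivrMr ?mul1r //; lra.
Qed.

Lemma value_base_lt p q d : 1 < p -> p < q -> digit_seq d ->
  0 < value p d -> value q d < value p d.
Proof.
move=> p1 pq dM v0; apply: le_lt_trans (value_base_ratio p1 (ltW pq) dM) _.
by rewrite gtr_pMl // ltr_pdivrMr ?mul1r //; lra.
Qed.

(** A sequence and its reflection add up to [M / (q - 1)] and both decrease in the base, so neither
    drops by more than the total. *)
Lemma value_base_diff p q d : 1 < p -> p <= q -> digit_seq d ->
  value p d - value q d <= M%:R / (p - 1) - M%:R / (q - 1).
Proof.
move=> p1 pq dM; have q1 : 1 < q by lra.
have := value_base_le p1 pq (digit_reflect d).
by rewrite !value_reflect //; lra.
Qed.

Lemma value_first_diff q d e m : 1 < q -> digit_seq d -> digit_seq e ->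
  (forall i, (i < m)%N -> d i = e i) ->
  value q e - value q d = q ^- m.+1 * ((e m)%:R - (d m)%:R +
    value q (shift_seq m.+1 e) - value q (shift_seq m.+1 d)).
Proof.
move=> q1 dM eM eq; rewrite (value_split m.+1 q1 dM) (value_split m.+1 q1 eM).
rewrite /partial_value !big_ord_recr /=.
rewrite -/(partial_value q d m) -/(partial_value q e m) (partial_value_ext q eq).
ring.
Qed.

Lemma value_agree q d e m : 1 < q -> digit_seq d -> digit_seq e ->
  (forall i, (i < m)%N -> d i = e i) ->
  `|value q e - value q d| <= q ^- m * (M%:R / (q - 1)).
Proof.
move=> q1 dM eM eq; rewrite (value_split m q1 dM) (value_split m q1 eM).
rewrite (partial_value_ext q eq) opprD addrACA subrr add0r -mulrBr normrM.
have q0 : 0 < q by lra.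
rewrite ger0_norm ?invr_ge0 ?exprn_ge0 ?(ltW q0) // ler_wpM2l ?invr_ge0 ?exprn_ge0 ?(ltW q0) //.
have dM' := digit_shift m dM; have eM' := digit_shift m eM.
have := (value_ge0 q1 dM', value_le_max q1 dM', value_ge0 q1 eM', value_le_max q1 eM').
by move=> [[[h1 h2] h3] h4]; rewrite ler_norml; lra.
Qed.

End Values.

(** * Expansions and the lexicographic characterization *)

Section Expansions.
Variables (R : realType) (M : nat).
Implicit Types (q p : R) (d e lam : nat -> nat).
Notation digit_seq := (digit_seq M).

(** Common source of the expansions below: each digit is chosen so that the remainder stays in the
    bounded set [I], and the remainders are the values of the tails. *)
Lemma expansion_in (I : R -> Prop) q B y : 1 < q ->
  (forall x, I x -> `|x| <= B) ->
  (forall x, I x -> exists2 c : nat, (c <= M)%N & I (q * x - c%:R)) ->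
  I y -> exists d, [/\ digit_seq d, value q d = y &
    forall k, I (value q (shift_seq k d))].
Proof.
move=> q1 IB Istep Iy.
have /choice[f fP] : forall x, exists c : nat,
    I x -> (c <= M)%N /\ I (q * x - c%:R).
  move=> x; have [/Istep[c cM Ic]|nI] := pselect (I x); first by exists c.
  by exists 0%N.
pose r k := iter k (fun x => q * x - (f x)%:R) y.
have Ir k : I (r k) by elim: k => [//|k /fP[]].
have rE k : value q (shift_seq k (f \o r)) = r k.
  rewrite (value_remainder (r := fun i => r (k + i)%N) (B := B)) ?addn0 //.
    by move=> i; exact: IB.
  by move=> i; rewrite addnS /shift_seq /= addrC subrK.
exists (f \o r); split=> [i||k]; [by case: (fP _ (Ir i))|exact: (rE 0%N)|].
by rewrite rE.
Qed.

Lemma digit_exists q x (Y : R) : 1 < q -> q * x - M%:R <= Y ->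
  exists c : nat, [/\ (c <= M)%N, q * x - c%:R <= Y &
    (0 < c)%N -> Y - 1 < q * x - c%:R].
Proof.
move=> q1 xM; have ex : exists c : nat, q * x - c%:R <= Y by exists M.
exists (ex_minn ex); case: ex_minnP => c cY cmin; split=> //; first exact: cmin.
case: c cY cmin => // c _ cmin _; rewrite -natr1.
suff : Y < q * x - c%:R by lra.
by rewrite ltNge; apply/negP => /cmin; rewrite ltnn.
Qed.

Lemma expansion_exists q y : 1 < q <= M.+1%:R -> 0 <= y <= M%:R / (q - 1) ->
  exists2 d, digit_seq d & value q d = y.
Proof.
move=> /andP[q1 qM] y_in; set Y := M%:R / (q - 1).
(* [Y] is the fixed point of the map from [x] to [q * x - M]; [1 <= Y] keeps the remainder
   nonnegative after a positive minimal digit. *)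
have Y1 : 1 <= Y by rewrite ler_pdivlMr ?mul1r; move: qM; rewrite -natr1; lra.
have YE : q * Y - M%:R = Y by rewrite /Y; field; rewrite subr_eq0 gt_eqF.
have [x /andP[x0 xY]|x /andP[x0 xY]|//|d [dM dE _]] :=
  @expansion_in (fun x => 0 <= x <= Y) q Y y q1.
- by rewrite ger0_norm.
- have [|c [cM cY c0]] := @digit_exists q x Y q1.
    by rewrite -[leRHS]YE lerD2r ler_wpM2l //; lra.
  exists c => //; rewrite cY andbT; have [->|/c0] := posnP c; last lra.
  by rewrite subr0 mulr_ge0 //; lra.
- by exists d.
Qed.

(** Keeping the remainders in ]0, 1] prevents them from vanishing, so the expansion is infinite: it
    is the quasi-greedy one. *)
Lemma quasi_greedy q : 1 < q <= M.+1%:R -> exists lam,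
  [/\ digit_seq lam, value q lam = 1 &
      forall k, 0 < value q (shift_seq k lam) <= 1].
Proof.
move=> /andP[q1 qM].
have [x /andP[x0 x1]|x /andP[x0 x1]|//|d [dM dE d_in]] :=
  @expansion_in (fun x => 0 < x <= 1) q 1 1 q1.
- by rewrite gtr0_norm.
- have [|c [cM cY c0]] := @digit_exists q x 1 q1.
    by rewrite lerBlDr addrC natr1; apply: le_trans qM; rewrite ler_piMr //; lra.
  exists c => //; rewrite cY andbT; have [->|/c0] := posnP c; last lra.
  by rewrite subr0 mulr_gt0 //; lra.
- by rewrite ltr01 lexx.
- by exists d.
Qed.

Lemma quasi_greedy_head_gt0 q lam : 1 < q -> digit_seq lam ->
  value q lam = 1 -> value q (shift_seq 1 lam) <= 1 -> (0 < lam 0)%N.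
Proof.
move=> q1 lamM lam1 le1; rewrite lt0n; apply/eqP => lam0.
by have := value_rec q1 lamM; rewrite lam1 lam0 mulr1; lra.
Qed.

(** A digit below [M] can be raised when the tail after it has value at least 1; lowering a positive
    digit is the mirror image. The criterion forbids both. *)
Definition univoque_criterion q d :=
  (forall k, (d k < M)%N -> value q (shift_seq k.+1 d) < 1) /\
  (forall k, (0 < d k)%N -> value q (reflect_seq M (shift_seq k.+1 d)) < 1).

Lemma univoque_criterion_reflect q d : digit_seq d ->
  univoque_criterion q d -> univoque_criterion q (reflect_seq M d).
Proof.
move=> dM [c1 c2]; split=> k dk.
  by apply: c2; move: dk; rewrite /reflect_seq; have := dM k; lia.
rewrite (_ : reflect_seq M _ = shift_seq k.+1 d).
  by apply: c1; move: dk; rewrite /reflect_seq; have := dM k; lia.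
by apply/funext => i; rewrite /reflect_seq /shift_seq subKn.
Qed.

Lemma value_first_diff_lt q d e m : 1 < q -> digit_seq d -> digit_seq e ->
  value q e = value q d -> (forall i, (i < m)%N -> d i = e i) ->
  (d m < e m)%N -> 1 <= value q (shift_seq m.+1 d).
Proof.
move=> q1 dM eM veq agree lt.
have := value_first_diff q1 dM eM agree; rewrite veq subrr => /esym/eqP.
rewrite mulf_eq0 invr_eq0 expf_eq0 /= gt_eqF /=; last lra.
have := value_ge0 q1 (digit_shift m.+1 eM).
have : (d m)%:R + 1 <= (e m)%:R :> R by rewrite natr1 ler_nat.
by move=> h1 h2 /eqP; lra.
Qed.

Lemma criterion_unique q d e : 1 < q -> digit_seq d -> digit_seq e ->
  univoque_criterion q d -> value q e = value q d -> e =1 d.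
Proof.
move=> q1 dM eM [c1 c2] veq; case: (eq_or_differ d e) => [eq i|[m [agree neq]]].
  by rewrite eq.
have [lt|lt] : (d m < e m)%N \/ (e m < d m)%N by lia.
  have := value_first_diff_lt q1 dM eM veq agree lt.
  by rewrite leNgt c1 //; have := eM m; lia.
have vreq : value q (reflect_seq M e) = value q (reflect_seq M d).
  by rewrite !value_reflect // veq.
have : 1 <= value q (shift_seq m.+1 (reflect_seq M d)).
  apply: (value_first_diff_lt q1 (digit_reflect _ d) (digit_reflect _ e) vreq).
    by move=> i /agree; rewrite /reflect_seq => ->.
  by rewrite /reflect_seq; have := dM m; lia.
by rewrite leNgt => /negP[]; apply: c2; lia.
Qed.

Lemma unique_value_lt q d k : 1 < q <= M.+1%:R -> digit_seq d ->
  (forall e, digit_seq e -> value q e = value q d -> e =1 d) ->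
  (d k < M)%N -> value q (shift_seq k.+1 d) < 1.
Proof.
move=> q_in dM uniq dk; have q1 : 1 < q by case/andP: q_in.
rewrite ltNge; apply/negP => v1.
have dM' := digit_shift k.+1 dM.
(* A tail of value at least 1 pays for raising digit [k] by 1; what remains is expanded anew. *)
have [|e' e'M e'E] := @expansion_exists q (value q (shift_seq k.+1 d) - 1) q_in.
  by have := value_le_max q1 dM'; lra.
pose e i := if (i < k)%N then d i else if i == k then (d k).+1 else e' (i - k.+1)%N.
have eM : digit_seq e by move=> i; rewrite /e; case: ifP => // _; case: ifP.
have := value_first_diff (m := k) q1 dM eM.
have -> : shift_seq k.+1 e = e'.
  apply/funext => i; rewrite /shift_seq /e !ifF; [congr e'|..]; lia.
have ek : e k = (d k).+1 by rewrite /e ltnn eqxx.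
rewrite ek e'E -natr1 => h.
have /(uniq _ eM)/(_ k) : value q e = value q d.
  apply/eqP; rewrite -subr_eq0 h; last by move=> i ik; rewrite /e ik.
  by rewrite (_ : _ - _ = 0) ?mulr0 //; ring.
by rewrite ek; lia.
Qed.

Lemma unique_criterion q d : 1 < q <= M.+1%:R -> digit_seq d ->
  (forall e, digit_seq e -> value q e = value q d -> e =1 d) ->
  univoque_criterion q d.
Proof.
move=> q_in dM uniq; split=> k dk; first exact: unique_value_lt.
have q1 : 1 < q by case/andP: q_in.
apply: (@unique_value_lt q (reflect_seq M d)) => //; first exact: digit_reflect.
  move=> e eM; rewrite value_reflect // => ve i.
  have := uniq (reflect_seq M e) (digit_reflect _ e).
  rewrite value_reflect // ve subKr => /(_ erefl)/(_ i); rewrite /reflect_seq.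
  by have := eM i; lia.
by rewrite /reflect_seq; have := dM k; lia.
Qed.

(** The bound survives a digit [M]: a tail of value [v < 1] that starts with [M] is followed by one
    of value [q * v - M < q - M <= 1]. *)
Lemma criterion_tail_lt q d j k : 1 < q <= M.+1%:R -> digit_seq d ->
  (forall k, (d k < M)%N -> value q (shift_seq k.+1 d) < 1) ->
  (d j < M)%N -> (j < k)%N -> value q (shift_seq k d) < 1.
Proof.
move=> /andP[q1 qM] dM c dj; elim: k => [//|k IH].
rewrite ltnS leq_eqVlt => /predU1P[<-|/IH vk]; first exact: c.
have [/c //|dk] := ltnP (d k) M.
have := value_rec q1 (digit_shift k dM); rewrite shift_add addn1 {2}/shift_seq addn0.
have -> : d k = M by apply/eqP; rewrite eqn_leq dM.
have : q * value q (shift_seq k d) < q by rewrite gtr_pMr //; lra.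
by move: qM; rewrite -natr1; lra.
Qed.

Lemma criterion_tail_reflect_lt q d j k : 1 < q <= M.+1%:R -> digit_seq d ->
  univoque_criterion q d -> (0 < d j)%N -> (j < k)%N ->
  value q (reflect_seq M (shift_seq k d)) < 1.
Proof.
move=> q_in dM /(univoque_criterion_reflect dM)[c _] dj jk.
apply: (@criterion_tail_lt q (reflect_seq M d) j k) => //.
  exact: digit_reflect.
by rewrite /reflect_seq; have := dM j; lia.
Qed.

(** At the first difference with [lam], the excess of a tail over 1 is bounded by a fraction of the
    excess of a later tail. Iteration leaves no positive excess, and the positive tails of [lam]
    give strictness. *)
Lemma lexlt_value_lt q lam d : 1 < q -> digit_seq lam -> digit_seq d ->
  value q lam = 1 -> (forall k, 0 < value q (shift_seq k lam)) ->
  (forall k, lexlt (shift_seq k d) lam) ->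
  forall k, value q (shift_seq k d) < 1.
Proof.
move=> q1 lamM dM lam1 lam0 lt; have q0 : 0 < q by lra.
set Y := M%:R / (q - 1); have Y0 : 0 <= Y by rewrite divr_ge0 //; lra.
have step k : exists m, value q (shift_seq k d) - 1 <=
    q ^- m.+1 * (value q (shift_seq (k + m.+1) d) - 1 - value q (shift_seq m.+1 lam)).
  have [m [agree ltm]] := lt k; exists m.
  have := value_first_diff q1 (digit_shift k dM) lamM agree.
  rewrite lam1 shift_add => vE.
  rewrite -[leLHS]opprB vE -mulrN ler_wpM2l ?invr_ge0 ?exprn_ge0 ?(ltW q0) //.
  have : (shift_seq k d m)%:R + 1 <= (lam m)%:R :> R by rewrite natr1 ler_nat.
  lra.
have small N : forall k, value q (shift_seq k d) - 1 <= q ^- N * Y.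
  elim: N => [|N IH] k.
    rewrite expr0 invr1 mul1r; have := value_le_max q1 (digit_shift k dM).
    by rewrite -/Y; lra.
  have [m vm] := step k; apply: (le_trans vm).
  have qm0 i : 0 <= q ^- i by rewrite invr_ge0 exprn_ge0 // ltW.
  apply: (@le_trans _ _ (q ^- m.+1 * (q ^- N * Y))).
    by rewrite ler_wpM2l //; have := IH (k + m.+1)%N; have := lam0 m.+1; lra.
  rewrite mulrA ler_wpM2r // -invfM -exprD lef_pV2 ?posrE ?exprn_gt0 //.
  by rewrite ler_weXn2l ?(ltW q1) //; lia.
have le1 k : value q (shift_seq k d) <= 1.
  rewrite -subr_le0; apply/ler_addgt0Pr => e e0; rewrite add0r.
  have cv : (fun N => Y * q^-1 ^+ N) @ \oo --> Y * 0.
    apply: cvgM; first exact: cvg_cst.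
    by apply: cvg_expr; rewrite gtr0_norm ?invr_gt0 // invf_lt1.
  move: cv; rewrite mulr0 => /cvgrPdist_lt/(_ e e0)[N _ /(_ N (leqnn N))] /=.
  rewrite sub0r normrN => hN; apply: le_trans (small N k) _.
  by rewrite mulrC -exprVn; apply: le_trans (ler_norm _) (ltW hN).
move=> k; have [m vm] := step k; rewrite -subr_lt0; apply: (le_lt_trans vm).
have : 0 < q ^- m.+1 by rewrite invr_gt0 exprn_gt0.
by move=> h; rewrite pmulr_rlt0 //; have := le1 (k + m.+1)%N; have := lam0 m.+1; lra.
Qed.

Lemma value_lt_lexlt q lam d : 1 < q -> digit_seq lam -> digit_seq d ->
  value q lam = 1 -> (forall k, value q (shift_seq k lam) <= 1) ->
  value q d < 1 -> lexlt d lam.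
Proof.
move=> q1 lamM dM lam1 le1 d1; have q0 : 0 < q by lra.
have [/(value_ext q)|//|[m [agree lt]]] := lexlt_total d lam.
  by rewrite lam1; lra.
have := value_first_diff q1 lamM dM agree; rewrite lam1.
have : 0 < q ^- m.+1 by rewrite invr_gt0 exprn_gt0.
have : (lam m)%:R + 1 <= (d m)%:R :> R by rewrite natr1 ler_nat.
have := value_ge0 q1 (digit_shift m.+1 dM); have := le1 m.+1 => h1 h2 h3 h4.
have : 0 <= q ^- m.+1 * ((d m)%:R - (lam m)%:R + value q (shift_seq m.+1 d) -
    value q (shift_seq m.+1 lam)) by apply: mulr_ge0; lra.
lra.
Qed.

Lemma quasi_greedy_max q lam k : 1 < q -> digit_seq lam -> value q lam = 1 ->
  (forall k, 0 < value q (shift_seq k lam) <= 1) ->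
  ~ lexlt lam (shift_seq k lam).
Proof.
move=> q1 lamM lam1 lam_in [m [agree lt]]; have q0 : 0 < q by lra.
have := value_first_diff q1 lamM (digit_shift k lamM) agree.
rewrite lam1 shift_add; have := lam_in k; have := lam_in m.+1.
have := lam_in (k + m.+1)%N; move=> /andP[h1 _] /andP[_ h2] /andP[_ h3].
have h4 : 0 < q ^- m.+1 by rewrite invr_gt0 exprn_gt0.
have h5 : (lam m)%:R + 1 <= (shift_seq k lam m)%:R :> R by rewrite natr1 ler_nat.
have : 0 < q ^- m.+1 * ((shift_seq k lam m)%:R - (lam m)%:R +
    value q (shift_seq (k + m.+1) lam) - value q (shift_seq m.+1 lam)).
  by apply: mulr_gt0; lra.
lra.
Qed.

Lemma reflect_lexlt d e : digit_seq d -> digit_seq e ->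
  lexlt (reflect_seq M d) e -> lexlt (reflect_seq M e) d.
Proof.
move=> dM eM [m [agree lt]]; exists m; rewrite /reflect_seq; split=> [i im|].
  by have := agree _ im; rewrite /reflect_seq; have := dM i; have := eM i; lia.
by move: lt; rewrite /reflect_seq; have := dM m; have := eM m; lia.
Qed.

(** By [value_base_diff] the variation is dominated by that of [M / (y - 1)]. *)
Lemma value_base_continuous d (x : R) : digit_seq d -> 1 < x ->
  {for x, continuous (fun y => value y d)}.
Proof.
move=> dM x1; apply/cvgrPdist_lt => e e0.
have cg : (fun y : R => M%:R / (y - 1)) y @[y --> x] --> M%:R / (x - 1).
  apply: cvgM; first exact: cvg_cst.
  apply: cvgV; first by rewrite subr_eq0 gt_eqF.
  by apply: cvgB; [exact: cvg_id|exact: cvg_cst].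
move/cvgrPdist_lt/(_ e e0) : cg; apply: filterS2 (lt_nbhsr x1) => y y1.
have [xy|yx] := leP x y.
  have := value_base_diff x1 xy dM; have := value_base_le x1 xy dM => h1 h2.
  by apply: le_lt_trans; rewrite !ger0_norm //; lra.
have := value_base_diff y1 (ltW yx) dM; have := value_base_le y1 (ltW yx) dM.
by move=> h1 h2; apply: le_lt_trans; rewrite !ler0_norm //; lra.
Qed.

Lemma value_base_ivt p q d : 1 < p -> p < q -> digit_seq d ->
  value q d < 1 -> 1 < value p d -> exists2 r, p < r < q & value r d = 1.
Proof.
move=> p1 pq dM vq vp.
have [||r] := @IVT R (fun y => value y d) p q 1 (ltW pq).
- apply: continuous_in_subspaceT => x; rewrite inE /= in_itv /= => /andP[px _].
  by apply: value_base_continuous => //; lra.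
- by rewrite ge_min le_max (ltW vq) (ltW vp) orbT.
rewrite in_itv /= => /andP[pr rq] vr; exists r => //.
by rewrite !lt_neqAle pr rq !andbT; apply/andP; split; apply/eqP => E;
  move: vr vq vp; rewrite ?E -?E; lra.
Qed.

End Expansions.

(** * Univoque bases *)

Section UnivoqueBases.
Variables (R : realType) (M : nat).
Implicit Types (q p : R).
Notation digit_seq := (digit_seq M).

Definition ord_seq (s : nat -> nat) : nat -> 'I_M.+1 := fun i => inord (s i).

Lemma ord_seqE s i : digit_seq s -> ord_seq s i = s i :> nat.
Proof. by move=> sM; rewrite inordK // ltnS; apply: sM. Qed.

Lemma ord_seqK s : digit_seq s -> (fun i => ord_seq s i : nat) = s.
Proof. by move=> sM; apply/funext => i; rewrite ord_seqE. Qed.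

Lemma digit_of_ord (d : nat -> 'I_M.+1) : digit_seq (fun i => d i).
Proof. by move=> i; rewrite -ltnS. Qed.

Lemma pi_baseE q (d : nat -> 'I_M.+1) : pi_base q d = value q (fun i => d i).
Proof. by []. Qed.

Lemma univoque_seqP q (d : nat -> 'I_M.+1) : 1 < q <= M.+1%:R ->
  univoque_seq M q d <-> univoque_criterion M q (fun i => d i).
Proof.
move=> q_in; have q1 : 1 < q by case/andP: q_in.
split=> [uniq|c e].
  apply: unique_criterion => //; first exact: digit_of_ord.
  move=> e eM ve i.
  have /(congr1 (fun f : nat -> 'I_M.+1 => f i : nat)) : ord_seq e = d.
    by apply: uniq; rewrite !pi_baseE ord_seqK.
  by rewrite ord_seqE.
rewrite !pi_baseE => ve; apply/funext => i; apply: val_inj => /=.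
have := criterion_unique q1 (digit_of_ord d) (digit_of_ord e) c ve.
exact.
Qed.

Lemma univoque_base_criterion q lam : 1 < q <= M.+1%:R -> digit_seq lam ->
  value q lam = 1 -> univoque_base R M q -> univoque_criterion M q lam.
Proof.
move=> q_in lamM lam1 [q1 [d [d1 uniq]]].
have dE : (fun i => d i : nat) = lam.
  by rewrite (uniq (ord_seq lam)) ?ord_seqK // pi_baseE ord_seqK.
rewrite -dE; apply/univoque_seqP => // e; rewrite d1 => e1.
by rewrite -(uniq _ e1).
Qed.

Lemma criterion_univoque_base q lam : 1 < q -> digit_seq lam ->
  value q lam = 1 -> univoque_criterion M q lam -> univoque_base R M q.
Proof.
move=> q1 lamM lam1 c; split=> //; exists (ord_seq lam); split.
  by rewrite pi_baseE ord_seqK.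
move=> e; rewrite pi_baseE => e1; apply/funext => i; apply: val_inj.
rewrite /= ord_seqE // -(criterion_unique q1 lamM (digit_of_ord e) c) //.
by rewrite e1.
Qed.

Lemma univoque_base_quasi_greedy q lam : 1 < q <= M.+1%:R -> digit_seq lam ->
  value q lam = 1 -> (forall k, 0 < value q (shift_seq k lam) <= 1) ->
  univoque_base R M q ->
  forall k, (0 < k)%N -> lexlt (reflect_seq M lam) (shift_seq k lam).
Proof.
move=> q_in lamM lam1 lam_in qU k k0; have q1 : 1 < q by case/andP: q_in.
have c := univoque_base_criterion q_in lamM lam1 qU.
have lam0 : (0 < lam 0)%N.
  by apply: (quasi_greedy_head_gt0 q1 lamM lam1); case/andP: (lam_in 1%N).
apply: reflect_lexlt => //; first exact: digit_shift.
apply: value_lt_lexlt lam1 _ _ => //; first exact: digit_reflect.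
  by move=> j; case/andP: (lam_in j).
exact: (criterion_tail_reflect_lt q_in lamM c lam0).
Qed.

Lemma univoque_base_of_lex p q s : 1 < p -> p < q -> digit_seq s ->
  (forall k, (0 < k)%N -> lexlt (shift_seq k s) s) ->
  (forall k, lexlt (reflect_seq M (shift_seq k s)) s) ->
  value q s < 1 -> 1 < value p s ->
  exists r, [/\ p < r < q, value r s = 1, univoque_base R M r,
    forall k, value r (shift_seq k.+1 s) < 1 &
    forall k, value r (reflect_seq M (shift_seq k s)) < 1].
Proof.
move=> p1 pq sM s_max s_low vq vp.
have [r /andP[pr rq] r1] := value_base_ivt p1 pq sM vq vp.
have r_gt1 : 1 < r by lra.
have s_pos k : 0 < value r (shift_seq k s).
  have [i si] : exists i, (0 < shift_seq k s i)%N.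
    apply/not_existsP => no; have [m [_]] := s_low k.
    rewrite /reflect_seq; have := sM m; have := no m; lia.
  exact: (value_gt0 r_gt1 (digit_shift k sM) si).
have lt1 k : value r (shift_seq k.+1 s) < 1.
  have := @lexlt_value_lt _ _ _ _ (shift_seq 1 s) r_gt1 sM (digit_shift 1 sM) r1 s_pos.
  move=> /(_ _ k); rewrite shift_add add1n; apply=> j.
  by rewrite shift_add; apply: s_max.
have lt2 k : value r (reflect_seq M (shift_seq k s)) < 1.
  have rE j : shift_seq j (reflect_seq M s) = reflect_seq M (shift_seq j s) by [].
  rewrite -rE; apply: (lexlt_value_lt r_gt1 sM (digit_reflect _ s) r1 s_pos).
  by move=> j; rewrite rE.
exists r; split=> //; first by rewrite pr.
by apply: (criterion_univoque_base r_gt1 sM r1); split=> k _.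
Qed.

Section Family.
Variables (n : nat) (a : nat -> nat).
Hypothesis aM : digit_seq a.
Hypothesis a_max : forall k, (0 < k)%N -> ~ lexlt a (shift_seq k a).
Hypothesis n_gt1 : (1 < n)%N.
Hypothesis n_good : good M a n.
Notation fam := (block_family M n a).

Lemma digit_family w : digit_seq (fam w).
Proof. exact: family_leq. Qed.

Let c0 : R := M.+1%:R ^- (7 * n + 1).
Let rho : R := M.+1%:R ^- (4 * n).

Lemma family_value_separation b w w' k : 1 < b <= M.+1%:R ->
  (forall k, value b (shift_seq k.+1 (fam w)) <= 1) ->
  (forall i, (i < k)%N -> w i = w' i) -> w k = false -> w' k ->
  value b (fam w) + c0 * rho ^+ k <= value b (fam w').
Proof.
move=> /andP[b1 bM] le1 eqw wk w'k; have b0 : 0 < b by lra.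
have [agree diff pos] := family_separation aM a_max n_gt1 n_good eqw wk w'k.
set m := ((4 * k + 5) * n + n.-1)%N in agree diff pos.
have := value_first_diff b1 (digit_family w) (digit_family w') agree.
rewrite diff -natr1 => vE.
have pos' : (0 < shift_seq m.+1 (fam w') n)%N by [].
have := value_ge_digit b1 (digit_shift m.+1 (digit_family w')) pos' => v1.
suff : c0 * rho ^+ k <= b ^- m.+1 * b ^- n.+1.
  move=> h; rewrite -lerBrDl vE; apply: le_trans h _.
  rewrite ler_wpM2l ?invr_ge0 ?exprn_ge0 ?(ltW b0) //.
  by have := le1 m; lra.
(* The exponents [m.+1], of the first difference, and [n.+1], of the positive digit, add up to
   [7 * n + 1 + 4 * n * k]; moreover [b <= M + 1]. *)
rewrite /c0 /rho exprVn -exprM -!invfM -!exprD.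
rewrite lef_pV2 ?posrE ?exprn_gt0 //; try lra.
rewrite (_ : (m.+1 + n.+1 = 7 * n + 1 + 4 * n * k)%N); last by rewrite /m; nia.
by rewrite lerXn2r // nnegrE ltW.
Qed.

Variables (p q : R).
Hypothesis p_gt1 : 1 < p.
Hypothesis p_lt_q : p < q.
Hypothesis fam_q : forall w, value q (fam w) < 1.
Hypothesis fam_p : forall w, 1 < value p (fam w).

Lemma family_base w : exists r, [/\ p < r < q, value r (fam w) = 1,
  univoque_base R M r, forall k, value r (shift_seq k.+1 (fam w)) < 1 &
  forall k, value r (reflect_seq M (shift_seq k (fam w))) < 1].
Proof.
apply: univoque_base_of_lex => //; first exact: digit_family.
  by move=> k; apply: family_shift.
by move=> k; apply: family_reflect.
Qed.

End Family.
End UnivoqueBases.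

(** * Hausdorff measure and dimension *)

Section Hausdorff.
Variable R : realType.
Implicit Types (A C E : set R) (s : R).

Lemma diam_ub A x y : A x -> A y -> (`|x - y|%:E <= diam A)%E.
Proof. by move=> Ax Ay; apply: ereal_sup_ubound; exists x => //; exists y. Qed.

Lemma diam_le A (D : R) : (forall x y, A x -> A y -> `|x - y| <= D) ->
  (diam A <= D%:E)%E.
Proof. by move=> AD; apply: ge_ereal_sup => _ [x Ax [y Ay <-]]; rewrite lee_fin AD. Qed.

Lemma diam_fin A (D : R) : A !=set0 -> (diam A <= D%:E)%E ->
  exists r, [/\ diam A = r%:E, 0 <= r <= D & forall x y, A x -> A y -> `|x - y| <= r].
Proof.
move=> [a Aa]; have := @diam_ub A; have := diam_ub Aa Aa; rewrite subrr normr0.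
case: (diam A) => [r| |] //= r0 ub rD; exists r; rewrite !lee_fin in r0 rD.
split=> [//||x y Ax Ay]; first by rewrite r0.
by have := ub _ _ Ax Ay; rewrite lee_fin.
Qed.

Lemma hausdorff_weight_ge0 s A : (0 <= hausdorff_weight s A)%E.
Proof. by rewrite /hausdorff_weight; case: ifP => // _; exact: poweR_ge0. Qed.

Lemma hausdorff_weight_le s A (D : R) : 0 <= s -> 0 <= D ->
  (diam A <= D%:E)%E -> (hausdorff_weight s A <= (D `^ s)%:E)%E.
Proof.
move=> s0 D0 AD; rewrite /hausdorff_weight.
case: ifPn => [_|/set0P/diam_fin/(_ AD)[r [-> /andP[r0 rD] _]]].
  by rewrite lee_fin powR_ge0.
by rewrite poweR_EFin lee_fin ge0_ler_powR.
Qed.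

Lemma hausdorff_content_ge0 s (delta : R) E : (0 <= hausdorff_content s delta E)%E.
Proof.
apply: le_ereal_inf_tmp => _ [C _ <-]; apply: nneseries_ge0 => *.
exact: hausdorff_weight_ge0.
Qed.

Lemma hausdorff_content_le s (delta : R) E :
  0 < delta -> (hausdorff_content s delta E <= hausdorff_measure s E)%E.
Proof. by move=> d0; apply: ereal_sup_ubound; exists delta. Qed.

Lemma hausdorff_null s E :
  (forall delta e : R, 0 < delta -> 0 < e -> exists C : nat -> set R,
    [/\ E `<=` \bigcup_i C i, forall i, (diam (C i) <= delta%:E)%E &
        (\sum_(0 <= i <oo) hausdorff_weight s (C i) <= e%:E)%E]) ->
  hausdorff_measure s E = 0%E.
Proof.
move=> cover; apply/eqP; rewrite eq_le; apply/andP; split; last first.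
  exact: le_trans (hausdorff_content_ge0 _ _ _) (hausdorff_content_le _ _ ltr01).
apply: ge_ereal_sup => _ [delta d0 <-]; apply/lee_addgt0Pr => e e0.
have [C [EC CD Ce]] := cover delta e d0 e0; rewrite add0e.
by apply: le_trans Ce; apply: ereal_inf_lbound; exists C.
Qed.

Lemma hausdorff_null_cover s E (delta e : R) : 0 < delta -> 0 < e ->
  hausdorff_measure s E = 0%E -> exists C : nat -> set R,
    [/\ E `<=` \bigcup_i C i, forall i, (diam (C i) <= delta%:E)%E &
        (\sum_(0 <= i <oo) hausdorff_weight s (C i) <= e%:E)%E].
Proof.
move=> d0 e0 E0; have : (hausdorff_content s delta E < e%:E)%E.
  by apply: le_lt_trans (hausdorff_content_le s E d0) _; rewrite E0 lte_fin.
by move=> /ereal_inf_lt[_ [C [EC CD] <-] /ltW Ce]; exists C.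
Qed.

Lemma hausdorff_null_bigcup s E (F : nat -> set R) :
  E `<=` \bigcup_i F i -> (forall i, hausdorff_measure s (F i) = 0%E) ->
  hausdorff_measure s E = 0%E.
Proof.
move=> EF F0; apply: hausdorff_null => delta e d0 e0.
have /choice[C CP] : forall i, exists C : nat -> set R,
    [/\ F i `<=` \bigcup_k C k, forall k, (diam (C k) <= delta%:E)%E &
      (\sum_(0 <= k <oo) hausdorff_weight s (C k) <= (e / (2 ^ i.+1)%:R)%:E)%E].
  by move=> i; apply: hausdorff_null_cover; rewrite ?divr_gt0.
have /card_esym/ppcard_eqP[f] := card_nat2.
pose G k := C (f k).1 (f k).2; exists G; split.
- move=> x /EF[i _]; case: (CP i) => FC _ _ /FC[k _ Cx].
  by exists (f^-1%FUN (i, k)) => //; rewrite /G invK ?inE.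
- by move=> k; case: (CP (f k).1) => _ CD _; exact: CD.
- rewrite nneseries_esumT; last by move=> *; exact: hausdorff_weight_ge0.
  rewrite -(@reindex_esum _ _ _ setT setT f
    (fun ik => hausdorff_weight s (C ik.1 ik.2))); last exact: 'bij_f.
  rewrite (_ : [set: nat * nat] = setT `*`` fun=> setT); last first.
    by apply/seteqP; split.
  rewrite -(@esum_esum _ _ _ setT (fun=> setT)
    (fun i k => hausdorff_weight s (C i k))); last first.
    by move=> *; exact: hausdorff_weight_ge0.
  rewrite -nneseries_esumT; last first.
    by move=> i; apply: esum_ge0 => *; exact: hausdorff_weight_ge0.
  apply: le_trans (epsilon_trick0 xpredT (ltW e0)).
  apply: lee_nneseries => [i _ _|i _].
    by apply: esum_ge0 => *; exact: hausdorff_weight_ge0.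
  rewrite -nneseries_esumT; last by move=> *; exact: hausdorff_weight_ge0.
  by case: (CP i).
Qed.

Lemma hausdorff_null_finite_covers s E : 0 < s ->
  (forall delta e : R, 0 < delta -> 0 < e -> exists (I : finType) (F : I -> set R) (D : R),
    [/\ E `<=` \bigcup_i F i, forall i, (diam (F i) <= D%:E)%E,
        0 <= D <= delta & #|I|%:R * D `^ s <= e]) ->
  hausdorff_measure s E = 0%E.
Proof.
move=> s0 cover; apply: hausdorff_null => delta e d0 e0.
have [I [F [D [EF FD /andP[D0 Dd] De]]]] := cover delta e d0 e0.
(* The finite cover is padded by empty sets, whose weight is 0. *)
pose C k := if insub k : option 'I_#|I| is Some j then F (enum_val j) else set0.
have w_le k : (hausdorff_weight s (C k) <=
    if (k < #|I|)%N then (D `^ s)%:E else 0)%E.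
  rewrite /C; case: insubP => [j -> _|/negbTE ->].
    exact: hausdorff_weight_le (ltW s0) D0 (FD _).
  by rewrite /hausdorff_weight eqxx.
exists C; split.
- move=> x /EF[i _ Fx]; exists (enum_rank i : nat) => //.
  rewrite /C; case: insubP => [j _ jE|]; last by rewrite ltn_ord.
  by rewrite (_ : j = enum_rank i) ?enum_rankK //; exact: val_inj.
- move=> k; rewrite /C; case: insubP => [j _ _|_]; last by apply: diam_le.
  by apply: le_trans (FD _) _; rewrite lee_fin.
- apply: lime_le; first by apply: is_cvg_nneseries => *; exact: hausdorff_weight_ge0.
  apply: nearW => k; apply: le_trans (_ : (_ <= ((minn k #|I|)%:R * D `^ s)%:E)%E) _.
    elim: k => [|k IH]; first by rewrite big_geq // min0n mul0r.
    rewrite big_nat_recr //=; apply: le_trans (leeD IH (w_le k)) _.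
    have [kI|Ik] := ltnP k #|I|.
      rewrite (minn_idPl kI) -EFinD lee_fin.
      by rewrite -[k.+1%:R]natr1 mulrDl mul1r.
    by rewrite (minn_idPr (leqW Ik)) adde0.
  rewrite lee_fin; apply: le_trans De; rewrite ler_wpM2r ?powR_ge0 // ler_nat.
  exact: geq_minr.
Qed.

Lemma hausdorff_dim_le E (s : R) : 0 <= s -> hausdorff_measure s E = 0%E ->
  (hausdorff_dim E <= s%:E)%E.
Proof. by move=> s0 E0; apply: ereal_inf_lbound; exists s. Qed.

Lemma hausdorff_dim_eq0 E : (forall s, 0 < s -> hausdorff_measure s E = 0%E) ->
  ~ (0 < hausdorff_dim E)%E.
Proof.
move=> null; apply/negP; rewrite -leNgt; apply/lee_addgt0Pr => e e0.
by rewrite add0e hausdorff_dim_le ?ltW // null.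
Qed.

Lemma hausdorff_measure_set0 s : 0 < s -> hausdorff_measure s set0 = 0%E.
Proof.
move=> s0; apply: hausdorff_null_finite_covers => // delta e d0 e0.
exists 'I_0, (fun=> set0), 0; split=> //; first by move=> i; exact: diam_le.
  by rewrite lexx ltW.
by rewrite card_ord mul0r ltW.
Qed.

Lemma hausdorff_dim_set0 : ~ (0 < hausdorff_dim (set0 : set R))%E.
Proof. exact/hausdorff_dim_eq0/hausdorff_measure_set0. Qed.

End Hausdorff.

(** * Dimension of Cantor sets and of block sets *)

Section CantorSets.
Variable R : realType.
Implicit Types (A C E : set R) (s : R) (w : nat -> bool).

Definition binary w : R := value 2 (fun i => w i : nat).

Lemma binary_surj (y : R) : 0 <= y <= 1 -> exists w, binary w = y.
Proof.
move=> y01; have [||d dM dE] := @expansion_exists R 1 2 y.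
- by rewrite ltr1n lexx.
- by rewrite (_ : 2 - 1 = 1) ?divr1 //; lra.
exists (fun i => d i == 1%N); rewrite -dE; apply: value_ext => i.
by have := dM i; case: (d i) => [|[|]].
Qed.

Lemma binary_agree w w' k : (forall i, (i < k)%N -> w i = w' i) ->
  `|binary w - binary w'| <= 2 ^- k.
Proof.
move=> eqw; rewrite distrC.
have := @value_agree R 1 2 (fun i => w i : nat) (fun i => w' i : nat) k.
rewrite (_ : 2 - 1 = 1 :> R) ?divr1 ?mulr1; last lra.
by apply=> [|i|i|i ik]; [rewrite ltr1n|case: (w i)|case: (w' i)|rewrite eqw].
Qed.

Section Separated.
Variables (f : (nat -> bool) -> R) (c0 rho : R).
Hypothesis c0_gt0 : 0 < c0.
Hypothesis rho_gt0 : 0 < rho.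
Hypothesis rho_lt1 : rho < 1.
Hypothesis f_sep : forall w w' k, (forall i, (i < k)%N -> w i = w' i) ->
  w k = false -> w' k -> c0 * rho ^+ k <= `|f w - f w'|.

Let s0 := ln 2 / - ln rho.

Let s0_gt0 : 0 < s0.
Proof.
by rewrite divr_gt0 ?ln_gt0 ?ltr1n // oppr_gt0 ln_lt0 // rho_gt0 rho_lt1.
Qed.

Let rho_s0 : rho `^ s0 = 2^-1.
Proof.
rewrite /powR gt_eqF // /s0 invrN mulrN mulNr divfK ?expRN ?lnK ?posrE //.
by rewrite lt_eqF // ln_lt0 // rho_gt0 rho_lt1.
Qed.

(* [rho `^ s0 = 1 / 2], so the binary value is a Hölder function of [f w]. *)
Lemma binary_hoelder w w' :
  `|binary w - binary w'| <= (c0 `^ s0)^-1 * `|f w - f w'| `^ s0.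
Proof.
wlog : w w' / exists k, [/\ forall i, (i < k)%N -> w i = w' i, w k = false & w' k].
  move=> wl; have [eqw|[k [eqw neq]]] :=
    eq_or_differ (fun i => w i : nat) (fun i => w' i : nat).
    have -> : w = w' by apply/funext => i; move: (eqw i); case: (w i); case: (w' i).
    by rewrite subrr normr0 mulr_ge0 ?powR_ge0 // invr_ge0 powR_ge0.
  have eqw' i : (i < k)%N -> w i = w' i.
    by move=> /eqw; case: (w i); case: (w' i).
  case Hw : (w k) neq; case Hw' : (w' k) => // _.
    rewrite distrC [X in _ <= _ * X `^ _]distrC; apply: wl.
    by exists k; split=> // i /eqw'.
  by apply: wl; exists k.
move=> [k [eqw wk w'k]]; rewrite -ler_pdivrMl ?invr_gt0 ?powR_gt0 // invrK.
have := f_sep eqw wk w'k => h.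
apply: le_trans (_ : c0 `^ s0 * 2 ^- k <= _).
  by rewrite ler_wpM2l ?powR_ge0 // binary_agree.
have -> : c0 `^ s0 * 2 ^- k = (c0 * rho ^+ k) `^ s0.
  rewrite powRM ?exprn_ge0 ?ltW // -powR_mulrn ?ltW // powRAC rho_s0.
  by rewrite powR_mulrn ?invr_ge0 // exprVn.
by rewrite ge0_ler_powR // ?nnegrE ?(ltW s0_gt0) // mulr_ge0 ?exprn_ge0 ?ltW.
Qed.

Let K := (c0 `^ s0)^-1.

Let K_gt0 : 0 < K.
Proof. by rewrite invr_gt0 powR_gt0. Qed.

(** The Hölder bound puts the binary values over [C] into an interval of length [2 * K] times the
    diameter to the power [s0]; since the diameter is at most 1, the exponent may be lowered to
    [s]. *)
Lemma binary_image_interval s C : 0 <= s <= s0 -> (diam C <= 1%:E)%E ->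
  exists I : set R, [/\ measurable I, forall w, C (f w) -> I (binary w) &
    (lebesgue_measure I <= (2 * K)%:E * hausdorff_weight s C)%E].
Proof.
move=> /andP[s_ge0 s_le] C1; have K2 : (0 <= (2 * K)%:E)%E by rewrite lee_fin mulr_ge0 // ltW // K_gt0.
have [[w0 Cw0]|no] := pselect (exists w, C (f w)); last first.
  exists set0; split=> // [w Cw|]; first by apply: no; exists w.
  by rewrite measure0 mule_ge0 // hausdorff_weight_ge0.
have C0 : C !=set0 by exists (f w0).
have [D [DE /andP[D0 D1] CD]] := diam_fin C0 C1.
pose l := K * D `^ s0; exists `[binary w0 - l, binary w0 + l]%classic.
split=> [//|w Cw|].
  rewrite /= in_itv /= -ler_distl; apply: le_trans (binary_hoelder _ _) _.
  rewrite ler_wpM2l ?(ltW K_gt0) // ge0_ler_powR ?nnegrE ?(ltW s0_gt0) //.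
  exact: CD.
have l0 : 0 <= l by rewrite mulr_ge0 ?powR_ge0 // ltW.
rewrite lebesgue_measure_itv /= lte_fin.
have -> : hausdorff_weight s C = (D `^ s)%:E.
  by rewrite /hausdorff_weight ifN ?DE ?poweR_EFin //; exact/set0P.
apply: (@le_trans _ _ (2 * l)%:E).
  case: ifP => _; last by rewrite lee_fin; lra.
  by rewrite -EFinB lee_fin; lra.
rewrite -EFinM lee_fin /l mulrA ler_wpM2l ?mulr_ge0 ?(ltW K_gt0) //.
(* For [D = 0] the left side is 0 because [s0 > 0], even when [s = 0] makes the right side 1. *)
have [->|Dneq] := eqVneq D 0; last by apply: ger_powR; rewrite ?D1 // lt_def Dneq D0.
by rewrite powR0 ?gt_eqF // powR_ge0.
Qed.

(** Every binary value occurs, so the intervals obtained from a cover of [E] cover [0, 1] and their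
    total length is at least 1. *)
Lemma cantor_content_ge s E : 0 <= s <= s0 -> (forall w, E (f w)) ->
  ((2 * K)^-1%:E <= hausdorff_content s 1 E)%E.
Proof.
move=> s_in Ef; apply: le_ereal_inf_tmp => _ [C [EC C1] <-].
have /choice[I IP] := fun i => binary_image_interval s_in (C1 i).
have mI i : measurable (I i) by case: (IP i).
have cover : `[0 : R, 1]%classic `<=` \bigcup_i I i.
  move=> y; rewrite /= in_itv /= => /binary_surj[w <-].
  have [i _ Ci] := EC _ (Ef w); exists i => //.
  by case: (IP i) => _ h _; exact: h.
have mu01 : lebesgue_measure (`[0 : R, 1]%classic : set R) = 1%E.
  by rewrite lebesgue_measure_itv /= lte_fin ltr01 sube0.
have mun : (1 <= \sum_(0 <= i <oo) lebesgue_measure (I i) :> \bar R)%E.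
  by rewrite -mu01; apply: measure_sigma_subadditive.
have : (1 <= (2 * K)%:E * \sum_(0 <= i <oo) hausdorff_weight s (C i))%E.
  rewrite -nneseriesZl; last by move=> *; exact: hausdorff_weight_ge0.
  apply: le_trans mun _; apply: lee_nneseries => // i _.
  by case: (IP i).
move=> h; have K2 : 0 < 2 * K by rewrite mulr_gt0.
rewrite -(@lee_pmul2l _ (2 * K)%:E) ?lte_fin //.
by rewrite -EFinM divff ?gt_eqF.
Qed.

Lemma cantor_dim_gt0 E : (forall w, E (f w)) -> (0 < hausdorff_dim E)%E.
Proof.
move=> Ef; apply: (@lt_le_trans _ _ s0%:E); first by rewrite lte_fin.
apply: le_ereal_inf_tmp => _ [s [s_ge0 Es0] <-]; rewrite lee_fin leNgt.
apply/negP => s_lt; have := hausdorff_content_le s E ltr01; rewrite Es0.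
have s_in : 0 <= s <= s0 by rewrite s_ge0 ltW.
move=> /(le_trans (cantor_content_ge s_in Ef)); rewrite lee_fin leNgt.
by rewrite invr_gt0 mulr_gt0.
Qed.

End Separated.
End CantorSets.

Section Blocks.
Variables (R : realType) (M : nat).
Hypothesis M_gt0 : (0 < M)%N.

Definition block_set L (pre : seq nat) (bs : seq (seq nat)) : set (nat -> nat) :=
  [set d | [/\ digit_seq M d, forall i, (i < size pre)%N -> d i = nth 0%N pre i &
    block_decomposition L bs (shift_seq (size pre) d)]].

(* The [4 ^ l] words of [l] blocks give intervals of length [2 ^ - (L * l)]. *)
Lemma block_set_null (s : R) L pre bs : 0 < s -> 2 < L%:R * s -> size bs = 4 ->
  hausdorff_measure s (value (M.+1%:R : R) @` block_set L pre bs) = 0%E.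
Proof.
move=> s0 Ls size_bs; apply: hausdorff_null_finite_covers => // delta e d0 e0.
have L0 : (0 < L)%N by case: L Ls => //; rewrite mul0r; lra.
pose x : R := 2^-1 ^+ L.
have x0 : 0 < x by rewrite exprn_gt0.
have x1 : x < 1 by rewrite exprn_ilt1 // -?lt0n // invf_lt1 // ltr1n.
(* The hypothesis on [L] gives [2 ^ (L * s) > 4], so the total weight of the [4 ^ l] intervals tends
   to 0. *)
have xs1 : 4 * x `^ s < 1.
  rewrite /x -powR_mulrn ?invr_ge0 // -powRrM -powR_inv1 // -powRrM mulN1r powRN.
  have h : (2 : R) `^ 2%:R < 2 `^ (L%:R * s).
    have ln2 : 0 < ln 2 :> R by rewrite ln_gt0 ?ltr1n.
    by rewrite /powR gt_eqF // ltr_expR ltr_pM2r.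
  rewrite powR_mulrn // in h.
  by rewrite ltr_pdivrMr ?powR_gt0 // mul1r; apply: le_lt_trans h; lra.
have pow_small (z t : R) : 0 <= z < 1 -> 0 < t ->
    exists l0, forall l, (l0 <= l)%N -> z ^+ l <= t.
  move=> /andP[z0 z1] t0; have /cvgrPdist_lt/(_ _ t0)[l0 _ lP] :
    (GRing.exp z : R^nat) @ \oo --> 0 by apply: cvg_expr; rewrite ger0_norm.
  exists l0 => l /lP /=; rewrite sub0r normrN => /ltW.
  exact: le_trans (ler_norm _).
have [l1 l1P] := pow_small x delta ltac:(by rewrite x1 ltW) d0.
have [l2 l2P] := pow_small (4 * x `^ s) e ltac:(by rewrite xs1 mulr_ge0 ?powR_ge0) e0.
pose l := maxn l1 l2.
pose F (u : {ffun 'I_l -> 'I_4}) := value (M.+1%:R : R) @` [set d |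
  [/\ digit_seq M d, forall i, (i < size pre)%N -> d i = nth 0%N pre i &
   forall (j : 'I_l) o, (o < L)%N ->
     d (size pre + (j * L + o))%N = nth 0%N (nth [::] bs (u j)) o]].
exists {ffun 'I_l -> 'I_4}, F, (x ^+ l); split.
- move=> _ [d [dM dpre dbs] <-].
  have /choice[u uP] : forall j : 'I_l, exists a : 'I_4, forall o, (o < L)%N ->
      d (size pre + (j * L + o))%N = nth 0%N (nth [::] bs a) o.
    move=> j; have [b /(nthP [::])[a a4 <-] bP] := dbs j.
    by rewrite size_bs in a4; exists (Ordinal a4) => o /bP.
  exists [ffun j => u j] => //; exists d => //; split=> // j o oL.
  by rewrite ffunE uP.
- move=> u; apply: diam_le => _ _ [d [dM dpre dP] <-] [d' [d'M d'pre d'P] <-].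
  have b1 : 1 < M.+1%:R :> R by rewrite ltr1n.
  have agree i : (i < size pre + l * L)%N -> d' i = d i.
    move=> il; have [ip|pi] := ltnP i (size pre); first by rewrite dpre ?d'pre.
    have jl : ((i - size pre) %/ L < l)%N by rewrite ltn_divLR //; lia.
    have oL := ltn_pmod (i - size pre) L0.
    have := dP (Ordinal jl) _ oL; have := d'P (Ordinal jl) _ oL.
    by rewrite /= -divn_eq subnKC // => -> ->.
  apply: le_trans (value_agree b1 d'M dM agree) _.
  rewrite -natr1 addrK divff ?mulr1 ?pnatr_eq0 -?lt0n //.
  rewrite /x -exprM exprVn lef_pV2 ?posrE ?exprn_gt0 //.
  apply: (@le_trans _ _ (M.+1%:R ^+ (L * l))).
    by rewrite lerXn2r ?nnegrE // ler_nat.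
  by rewrite natr1 ler_weXn2l ?ler1n //; lia.
- by rewrite exprn_ge0 ?(ltW x0) //= l1P // leq_maxl.
- have -> : (x ^+ l) `^ s = (x `^ s) ^+ l.
    by rewrite -powR_mulrn ?(ltW x0) // powRAC powR_mulrn ?powR_ge0.
  by rewrite card_ffun !card_ord natrX -exprMn l2P // leq_maxr.
Qed.

End Blocks.

(** * Positive dimension next to a univoque base *)

Section PositiveDimension.
Variables (R : realType) (M n : nat) (a : nat -> nat) (p q : R).
Hypothesis M_gt0 : (0 < M)%N.
Hypothesis aM : digit_seq M a.
Hypothesis a_max : forall k, (0 < k)%N -> ~ lexlt a (shift_seq k a).
Hypothesis n_gt1 : (1 < n)%N.
Hypothesis n_good : good M a n.
Hypothesis p_gt1 : 1 < p.
Hypothesis p_lt_q : p < q.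
Hypothesis q_le : q <= M.+1%:R.
Notation fam := (block_family M n a).
Hypothesis fam_q : forall w, value q (fam w) < 1.
Hypothesis fam_p : forall w, 1 < value p (fam w).

Definition separation_scale : R := M.+1%:R ^- (7 * n + 1).
Notation c0 := separation_scale.

Definition separation_ratio : R := M.+1%:R ^- (4 * n).
Notation rho := separation_ratio.

Lemma separation_scale_gt0 : 0 < c0.
Proof. by rewrite invr_gt0 exprn_gt0. Qed.

Lemma separation_ratio_gt0 : 0 < rho.
Proof. by rewrite invr_gt0 exprn_gt0. Qed.

Lemma separation_ratio_lt1 : rho < 1.
Proof. by rewrite invf_lt1 ?exprn_gt0 // exprn_egt1 ?ltr1n //; lia. Qed.

Local Hint Resolve separation_scale_gt0 separation_ratio_gt0 separation_ratio_lt1 : core.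

(** In base [r w] the value of [fam w'] exceeds 1 by the separation of the family. Moving the base
    to [r w'] must remove this excess, and above [p] a value changes by at most [M / (p - 1) ^+ 2]
    times the change of the base. *)
Lemma family_bases_dim :
  (0 < hausdorff_dim (univoque_base R M `&` `]p, q[%classic))%E.
Proof.
have famM := digit_family aM n_gt1.
have [p1 pq qM] := And3 p_gt1 p_lt_q q_le.
have /choice[r rP] := family_base aM a_max n_gt1 n_good p_gt1 p_lt_q fam_q fam_p.
have M0 : 0 < M%:R :> R by rewrite ltr0n.
have p0 : 0 < p - 1 by rewrite subr_gt0.
apply: (@cantor_dim_gt0 R r (c0 * (p - 1) ^+ 2 / M%:R) rho) => //.
- by rewrite divr_gt0 // mulr_gt0 // exprn_gt0.
- move=> w w' k eqw wk w'k.
  have [/andP[pr rq] r1 _ rlt _] := rP w; have [/andP[pr' rq'] r1' _ _ _] := rP w'.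
  have r_in : 1 < r w <= M.+1%:R by apply/andP; split; lra.
  have := family_value_separation aM a_max n_gt1 n_good r_in
    (fun k => ltW (rlt k)) eqw wk w'k.
  rewrite r1 -/c0 -/rho => sep.
  have delta0 : 0 < c0 * rho ^+ k by rewrite mulr_gt0 // exprn_gt0.
  have lt_rr' : r w < r w'.
    rewrite ltNge; apply/negP => le.
    by have := value_base_le (lt_trans p_gt1 pr') le (famM w'); rewrite r1'; lra.
  have rw1 : 1 < r w by lra.
  have := value_base_diff rw1 (ltW lt_rr') (famM w'); rewrite r1' => diff.
  rewrite distrC ger0_norm; last lra.
  have : M%:R / (r w - 1) - M%:R / (r w' - 1) <= M%:R * (r w' - r w) / (p - 1) ^+ 2.
    rewrite (_ : _ - _ = M%:R * (r w' - r w) / ((r w - 1) * (r w' - 1))); last first.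
      by field; rewrite !subr_eq0 !gt_eqF //; lra.
    rewrite ler_wpM2l ?mulr_ge0 //; first lra.
    rewrite lef_pV2 ?posrE ?mulr_gt0 ?exprn_gt0 //; try lra.
    by rewrite expr2 ler_pM //; lra.
  move=> /(le_trans diff) h.
  rewrite (_ : _ * rho ^+ k = c0 * rho ^+ k * (p - 1) ^+ 2 / M%:R); last by ring.
  rewrite ler_pdivrMr // -ler_pdivlMr ?exprn_gt0 // [_ * M%:R]mulrC.
  by apply: le_trans h; lra.
- move=> w; have [pr _ rU _ _] := rP w.
  by split=> //=; rewrite in_itv.
Qed.

Definition cons0 (s : nat -> nat) i := if i is j.+1 then s j else 0%N.

Lemma digit_cons0 s : digit_seq M s -> digit_seq M (cons0 s).
Proof. by move=> sM [|i] //=; apply: sM. Qed.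

(* The digit 0 in front turns [value p (fam w) > 1] into a failure of the
   criterion in base [p]. *)
Lemma family_sequences_dim :
  (0 < hausdorff_dim (pi_base (M.+1%:R : R) @`
     (univoque_seq M q `\` univoque_seq M p)))%E.
Proof.
have famM := digit_family aM n_gt1.
have [p1 pq qM] := And3 p_gt1 p_lt_q q_le.
have q1 : 1 < q by lra.
have b1 : 1 < M.+1%:R :> R by rewrite ltr1n.
have b0 : 0 < M.+1%:R :> R by rewrite ltr0n.
pose f w : R := pi_base (M.+1%:R : R) (ord_seq M (cons0 (fam w))).
have fE w : f w = value (M.+1%:R : R) (fam w) / M.+1%:R.
  have := value_rec b1 (digit_cons0 (famM w)).
  rewrite (_ : shift_seq 1 _ = fam w) // /f pi_baseE (ord_seqK (digit_cons0 (famM w))).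
  by rewrite add0r => <-; rewrite mulrC mulKf // gt_eqF.
apply: (@cantor_dim_gt0 R f (c0 / M.+1%:R) rho) => //.
- by rewrite divr_gt0.
- move=> w w' k eqw wk w'k; rewrite !fE -mulrBl normrM [`|_^-1|]gtr0_norm ?invr_gt0 //.
  rewrite mulrAC ler_pM2r ?invr_gt0 //.
  have b_in : 1 < (M.+1%:R : R) <= M.+1%:R by rewrite b1 lexx.
  have := family_value_separation aM a_max n_gt1 n_good b_in _ eqw wk w'k.
  rewrite -/c0 -/rho distrC => sep; apply: le_trans (ler_norm _).
  rewrite lerBrDl; apply: sep => j.
  have := value_le_max b1 (digit_shift j.+1 (famM w)).
  by rewrite -{2}natr1 addrK divff // pnatr_eq0 -lt0n.
- move=> w; exists (ord_seq M (cons0 (fam w))) => //.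
  have [r [/andP[pr rq] _ _ rlt rlt']] := family_base aM a_max n_gt1 n_good p_gt1 p_lt_q fam_q fam_p w.
  have r1 : 1 < r by lra.
  split; apply/univoque_seqP; rewrite ?(ord_seqK (digit_cons0 (famM w))).
  + by rewrite q1.
  (* Proper tails and reflected tails are below 1 in base [r], hence also in the larger base [q]. *)
  + split=> [[|k] _|[|k] //= _].
    * exact: fam_q.
    * rewrite (_ : shift_seq _ _ = shift_seq k.+1 (fam w)) //.
      apply: le_lt_trans (rlt k); apply: value_base_le => //; first exact: ltW.
      exact: digit_shift.
    * rewrite (_ : shift_seq _ _ = shift_seq k.+1 (fam w)) //.
      apply: le_lt_trans (rlt' k.+1); apply: value_base_le => //; first exact: ltW.
      exact: digit_reflect.
  + rewrite p_gt1 /=; lra.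
  + by case=> /(_ 0%N M_gt0); rewrite (_ : shift_seq _ _ = fam w) // => h _; have := fam_p w; lra.
Qed.

End PositiveDimension.

(** * Sequences sharing a long prefix with an expansion of 1 *)

Section Agreement.
Variables (R : realType) (M : nat).

Lemma value_agree_close (b : R) a (e : R) : 1 < b -> digit_seq M a -> 0 < e ->
  exists N, forall d n, (N <= n)%N -> digit_seq M d ->
    (forall i, (i < n)%N -> d i = a i) -> `|value b d - value b a| < e.
Proof.
move=> b1 aM e0; have b0 : 0 < b by lra.
have : (fun m => M%:R / (b - 1) * b^-1 ^+ m) @ \oo --> M%:R / (b - 1) * (0 : R).
  apply: cvgM; first exact: cvg_cst.
  by apply: cvg_expr; rewrite gtr0_norm ?invr_gt0 // invf_lt1.
rewrite mulr0 => /cvgrPdist_lt/(_ e e0)[N _ NP]; exists N => d n Nn dM agree.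
have := NP n Nn; rewrite /= sub0r normrN => h.
apply: le_lt_trans h; rewrite exprVn mulrC.
apply: le_trans (ler_norm _); rewrite mulrC distrC.
have agree' i : (i < n)%N -> d i = a i := agree i.
by rewrite [leRHS]mulrC; apply: value_agree.
Qed.

Lemma prefix_value_gt1 (p r : R) lam : 1 < p -> p < r -> digit_seq M lam ->
  value r lam = 1 -> exists N, forall d n, (N <= n)%N -> digit_seq M d ->
    (forall i, (i < n)%N -> d i = lam i) -> 1 < value p d.
Proof.
move=> p1 pr lamM lam1; have r1 : 1 < r by lra.
have v1 : 1 < value p lam.
  rewrite -lam1; apply: value_base_lt => //.
  by apply: lt_le_trans (value_base_le p1 (ltW pr) lamM); rewrite lam1.
have e0 : 0 < value p lam - 1 by lra.
have [N NP] := value_agree_close p1 lamM e0.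
exists N => d n Nn dM /(NP d n Nn dM); rewrite ltr_norml; lra.
Qed.

Lemma prefix_value_lt1 (q r : R) lam : 1 < r -> r < q -> digit_seq M lam ->
  value r lam = 1 -> exists N, forall d n, (N <= n)%N -> digit_seq M d ->
    (forall i, (i < n)%N -> d i = lam i) -> value q d < 1.
Proof.
move=> r1 rq lamM lam1.
have v1 : value q lam < 1.
  by rewrite -lam1; apply: value_base_lt; rewrite ?lam1.
have e0 : 0 < 1 - value q lam by lra.
have [N NP] := value_agree_close (lt_trans r1 rq) lamM e0.
exists N => d n Nn dM /(NP d n Nn dM); rewrite ltr_norml; lra.
Qed.

Lemma univoque_base_dims (p q r : R) : (0 < M)%N -> 1 < p -> p < r -> r < q ->
  q <= M.+1%:R -> univoque_base R M r ->
  (0 < hausdorff_dim (univoque_base R M `&` `]p, q[%classic))%E /\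
  (0 < hausdorff_dim (pi_base (M.+1%:R : R) @`
     (univoque_seq M q `\` univoque_seq M p)))%E.
Proof.
move=> M0 p1 pr rq qM rU; have r_in : 1 < r <= M.+1%:R by apply/andP; split; lra.
have r1 : 1 < r by lra.
have [a [aM a1 a_in]] := quasi_greedy r_in.
have a_max k : (0 < k)%N -> ~ lexlt a (shift_seq k a).
  by move=> _; apply: (quasi_greedy_max r1 aM a1 a_in).
have a_low := univoque_base_quasi_greedy r_in aM a1 a_in rU.
have [N1 N1P] := prefix_value_gt1 p1 pr aM a1.
have [N2 N2P] := prefix_value_lt1 r1 rq aM a1.
(* Beyond [N1] and [N2] the prefix alone forces values above 1 in base [p] and below 1 in base
   [q]. *)
have [n nN n_good] := good_exists aM a_max a_low (maxn 2 (maxn N1 N2)).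
have n1 : (1 < n)%N by lia.
have fam_q w : value q (block_family M n a w) < 1.
  apply: (N2P _ n) => [||i]; [lia|exact: (digit_family aM n1)|exact: family_prefix].
have fam_p w : 1 < value p (block_family M n a w).
  apply: (N1P _ n) => [||i]; [lia|exact: (digit_family aM n1)|exact: family_prefix].
have pq : p < q by lra.
split; first exact: (family_bases_dim M0 aM a_max n1 n_good p1 pq qM fam_q fam_p).
exact: (family_sequences_dim M0 aM a_max n1 n_good p1 pq qM fam_q fam_p).
Qed.

End Agreement.

(** * Zero dimension in the absence of univoque bases *)

Section ZeroDimension.
Variables (R : realType) (M : nat).

Lemma block_decomposition_reflect L bs d : digit_seq M d ->
  block_decomposition L bs (reflect_seq M d) ->
  block_decomposition L
    [seq mkseq (fun o => M - nth 0 b o)%N L | b <- bs] d.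
Proof.
move=> dM dbs j; have [b bbs bP] := dbs j.
exists (mkseq (fun o => M - nth 0 b o)%N L).
  exact: (map_f (fun b => mkseq (fun o => M - nth 0 b o)%N L)).
by move=> o oL; rewrite nth_mkseq // -bP // /reflect_seq subKn.
Qed.

(** If [y] first falls below [lam] before position [N], its value in base [q] is at most [1 - e] for
    a fixed [e > 0], and a base close enough to [q] cannot make up for this. *)
Lemma value_close_prefix (q : R) lam N : 1 < q -> digit_seq M lam ->
  value q lam = 1 -> (forall k, 0 < value q (shift_seq k lam)) ->
  exists2 p, 1 < p < q & forall y, digit_seq M y ->
    (forall k, value q (shift_seq k y) < 1) -> lexlt y lam ->
    1 <= value p y -> forall i, (i < N)%N -> y i = lam i.
Proof.
move=> q1 lamM lam1 lam0; have q0 : 0 < q by lra.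
have [e e0 eP] : exists2 e : R, 0 < e & forall m, (m < N)%N ->
    e <= q ^- m.+1 * value q (shift_seq m.+1 lam).
  elim: N => [|N [e e0 eP]]; first by exists 1.
  exists (Num.min e (q ^- N.+1 * value q (shift_seq N.+1 lam))).
    by rewrite lt_min e0 /= mulr_gt0 // invr_gt0 exprn_gt0.
  move=> m; rewrite ltnS leq_eqVlt => /predU1P[->|/eP h].
    by rewrite ge_min lexx orbT.
  by rewrite ge_min h.
have b0 : 0 < M.+1%:R :> R by rewrite ltr0n.
(* With [t] so chosen, [M / (p - 1) - M / (q - 1)] for the base [p] below equals [M / (M + 1) * e],
   which is less than [e]. *)
have [t t0 tE] : exists2 t, 0 < t & t = e * (q - 1) / M.+1%:R.
  by exists (e * (q - 1) / M.+1%:R) => //; rewrite divr_gt0 // mulr_gt0 // subr_gt0.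
have p1 : 1 < 1 + (q - 1) / (1 + t).
  by rewrite ltrDl divr_gt0 //; lra.
have pq : 1 + (q - 1) / (1 + t) < q.
  by rewrite -ltrBrDl ltr_pdivrMr ?ltr_pMr //; lra.
exists (1 + (q - 1) / (1 + t)); first by rewrite p1.
move=> y yM y_lt [m [agree ltm]] yp i iN.
have [im|mi] := ltnP i m; first exact: agree.
exfalso; suff : value (1 + (q - 1) / (1 + t)) y < 1 by lra.
have := value_base_diff p1 (ltW pq) yM.
have -> : M%:R / (1 + (q - 1) / (1 + t) - 1) - M%:R / (q - 1) =
    M%:R / M.+1%:R * e :> R.
  have -> : M%:R / M.+1%:R * e = M%:R * t / (q - 1).
    by rewrite tE; field; rewrite !gt_eqF // subr_gt0.
  by field; rewrite !gt_eqF ?subr_gt0 ?addr_gt0 //; lra.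
have eM : M%:R / M.+1%:R * e < e.
  by rewrite gtr_pMl // ltr_pdivrMr // mul1r ltr_nat.
have := value_first_diff q1 yM lamM agree; rewrite lam1.
have e_le := eP m (leq_ltn_trans mi iN).
have : q ^- m.+1 * value q (shift_seq m.+1 lam) <= q ^- m.+1 *
    ((lam m)%:R - (y m)%:R + value q (shift_seq m.+1 lam) - value q (shift_seq m.+1 y)).
  rewrite ler_wpM2l ?invr_ge0 ?exprn_ge0 ?(ltW q0) //.
  have : (y m)%:R + 1 <= (lam m)%:R :> R by rewrite natr1 ler_nat.
  by have := y_lt m.+1; lra.
move: eM e_le; move: (_ * e) (_ * value q _) (_ * (_ + _ - _)) => A B C.
lra.
Qed.

(** The criterion bounds reflected tails only after a positive digit, here the first digit of [y];
    so shift 0 is left out for the reflection. *)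
Definition tail_bounded (q : R) lam y :=
  [/\ digit_seq M y, forall k, lexlt (shift_seq k y) lam &
      forall k, (0 < k)%N -> lexlt (reflect_seq M (shift_seq k y)) lam].

(** Up to reflection, failure in base [p] gives a digit below [M] followed by a tail of value at
    least 1. In base [q] this tail and its shifts are below 1, hence below [lam], and [close]
    applies. *)
Lemma criterion_not_criterion_tail (p q : R) lam N d : 1 < q <= M.+1%:R ->
  digit_seq M lam -> value q lam = 1 ->
  (forall k, 0 < value q (shift_seq k lam) <= 1) ->
  (forall y, digit_seq M y -> (forall k, value q (shift_seq k y) < 1) ->
    lexlt y lam -> 1 <= value p y -> forall i, (i < N.+1)%N -> y i = lam i) ->
  digit_seq M d -> univoque_criterion M q d -> ~ univoque_criterion M p d ->
  exists k, exists2 y, y = shift_seq k d \/ y = shift_seq k (reflect_seq M d) &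
    tail_bounded q lam y /\ forall i, (i < N.+1)%N -> y i = lam i.
Proof.
move=> q_in lamM lam1 lam_in close dM dq dp; have q1 : 1 < q by case/andP: q_in.
have lam0 : (0 < lam 0)%N.
  by apply: (quasi_greedy_head_gt0 q1 lamM lam1); case/andP: (lam_in 1%N).
have [k [D [DE DM Dq Dk Dp]]] : exists k D, [/\ D = d \/ D = reflect_seq M d,
    digit_seq M D, univoque_criterion M q D, (D k < M)%N &
    1 <= value p (shift_seq k.+1 D)].
  apply: contrapT => no; apply: dp; split=> k dk; rewrite ltNge; apply/negP => v1.
    by apply: no; exists k, d; split=> //; left.
  apply: no; exists k, (reflect_seq M d); split=> //; first by right.
  - exact: digit_reflect.
  - exact: univoque_criterion_reflect.
  - by rewrite /reflect_seq; have := dM k; lia.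
have Dk1 j : value q (shift_seq j (shift_seq k.+1 D)) < 1.
  by rewrite shift_add; case: Dq => c _; apply: (criterion_tail_lt q_in DM c Dk); lia.
have lam_le j : value q (shift_seq j lam) <= 1 by case/andP: (lam_in j).
have Dlex j : lexlt (shift_seq j (shift_seq k.+1 D)) lam.
  by apply: (value_lt_lexlt q1 lamM _ lam1 lam_le) => //; do 2 apply: digit_shift.
have agree := close _ (digit_shift k.+1 DM) Dk1 (Dlex 0%N) Dp.
exists k.+1, (shift_seq k.+1 D); first by case: DE => ->; [left|right].
split=> //; split=> [|//|j j0]; first exact: digit_shift.
apply: (value_lt_lexlt q1 lamM _ lam1 lam_le); first exact: digit_reflect.
rewrite shift_add; apply: (criterion_tail_reflect_lt q_in DM Dq (j := k.+1)).
  by have := agree 0%N isT; rewrite /shift_seq addn0 => ->.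
by lia.
Qed.

(** The shift of [y] lies in between: its reflection is below [lam], and it is below the shift of
    [lam] because [y] is below [lam] but agrees with it for [k] digits. *)
Lemma tail_bounded_low q lam y k : digit_seq M lam -> (0 < k)%N ->
  tail_bounded q lam y -> (forall i, (i < k)%N -> y i = lam i) ->
  lexlt (reflect_seq M lam) (shift_seq k lam).
Proof.
move=> lamM k0 [yM y_lt y_low] agree.
apply: (lexlt_trans (b := shift_seq k y)).
  by apply: reflect_lexlt => //; [exact: digit_shift|exact: y_low].
have [m [eqm ltm]] : lexlt y lam := y_lt 0%N.
have km : (k <= m)%N by rewrite leqNgt; apply/negP => /agree; lia.
exists (m - k)%N; rewrite /shift_seq; split=> [i im|].
  by apply: eqm; lia.
by rewrite subnKC.
Qed.

(* Otherwise the family built on the prefix of length n would lie below [lam]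
   and produce a univoque base in ]p, q[. *)
Lemma good_prefix_double (p q : R) lam n : 1 < p -> p < q -> q <= M.+1%:R ->
  digit_seq M lam -> value q lam = 1 ->
  (forall k, 0 < value q (shift_seq k lam) <= 1) ->
  (forall k, (0 < k)%N -> lexlt (reflect_seq M lam) (shift_seq k lam)) ->
  (forall d, digit_seq M d -> (forall i, (i < n)%N -> d i = lam i) -> 1 < value p d) ->
  univoque_base R M `&` `]p, q[%classic = set0 ->
  (1 < n)%N -> good M lam n ->
  [/\ forall j, (j.+1 < n)%N -> lam (n + j)%N = (M - lam j)%N,
      lam (n + n.-1)%N = (M - lam n.-1).+1 & good M lam (n + n)].
Proof.
move=> p1 pq qM lamM lam1 lam_in lam_low prefix_p noU n1 n_good.
have q1 : 1 < q by lra.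
have lam_max k : (0 < k)%N -> ~ lexlt lam (shift_seq k lam).
  by move=> _; apply: (quasi_greedy_max q1 lamM lam1 lam_in).
apply: (good_double lamM lam_max n1 n_good (w := fun=> false) lam_low) => lt.
set s := block_family M n lam _ in lt.
have sM : digit_seq M s by exact: digit_family lamM n1 _.
have s_max k : (0 < k)%N -> lexlt (shift_seq k s) s.
  by move=> k0; apply: family_shift.
have sq : value q s < 1.
  apply: (lexlt_value_lt q1 lamM sM lam1 _ _ 0%N) => k.
    by case/andP: (lam_in k).
  have [->|k0] := posnP k; first exact: lt.
  exact: lexlt_trans (s_max k k0) lt.
have sp : 1 < value p s by apply: prefix_p => // i; apply: family_prefix.
have s_low k : lexlt (reflect_seq M (shift_seq k s)) s by apply: family_reflect.
have [r [pr _ rU _ _]] := univoque_base_of_lex p1 pq sM s_max s_low sq sp.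
suff : (univoque_base R M `&` `]p, q[%classic) r by rewrite noU.
by split=> //=; rewrite in_itv.
Qed.

Lemma zero_dimension (p q : R) : (0 < M)%N -> 1 < p -> p < q -> q <= M.+1%:R ->
  univoque_base R M `&` `]p, q[%classic = set0 ->
  exists2 p', 1 < p' < q & ~ (0 < hausdorff_dim (pi_base (M.+1%:R : R) @`
     (univoque_seq M q `\` univoque_seq M p')))%E.
Proof.
move=> M0 p1 pq qM noU; have q1 : 1 < q by lra.
have q_in : 1 < q <= M.+1%:R by rewrite q1.
have [lam [lamM lam1 lam_in]] := quasi_greedy q_in.
have lam_pos k : 0 < value q (shift_seq k lam) by case/andP: (lam_in k).
have close N : exists2 p', 1 < p' < q & forall d,
    (univoque_seq M q `\` univoque_seq M p') d ->
    exists k, exists2 y, y = shift_seq k (fun i => d i : nat) \/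
        y = shift_seq k (reflect_seq M (fun i => d i)) &
      tail_bounded q lam y /\ forall i, (i < N.+1)%N -> y i = lam i.
  have [p' /andP[p'1 p'q] close] := value_close_prefix N.+1 q1 lamM lam1 lam_pos.
  have p'_in : 1 < p' <= M.+1%:R by rewrite p'1 /=; lra.
  exists p'; first by rewrite p'1.
  move=> d [/(univoque_seqP d q_in) dq /(univoque_seqP d p'_in) dp].
  by apply: criterion_not_criterion_tail close _ dq dp => //; exact: digit_of_ord.
have [lam_low|] := pselect (forall k, (0 < k)%N ->
    lexlt (reflect_seq M lam) (shift_seq k lam)); last first.
  move=> /existsNP[k /not_implyP[k0 nlow]].
  have [p' p'_in p'P] := close k; exists p' => //.
  (* A tail that agrees with [lam] on its first [k] digits would prove the comparison that fails at
     [k]. *)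
  suff -> : univoque_seq M q `\` univoque_seq M p' = set0.
    by rewrite image_set0; exact: hausdorff_dim_set0.
  rewrite -subset0 => d /p'P[j [y _ [y_bd agree]]]; apply: nlow.
  by apply: (tail_bounded_low lamM k0 y_bd) => i ik; apply: agree; lia.
have lam_max k : (0 < k)%N -> ~ lexlt lam (shift_seq k lam).
  by move=> _; apply: (quasi_greedy_max q1 lamM lam1 lam_in).
have [N0 N0P] := prefix_value_gt1 p1 pq lamM lam1.
have [n nN n_good] := good_exists lamM lam_max lam_low (maxn 2 N0).
have n1 : (1 < n)%N by lia.
have step n' : (n <= n')%N -> good M lam n' ->
    [/\ forall j, (j.+1 < n')%N -> lam (n' + j)%N = (M - lam j)%N,
      lam (n' + n'.-1)%N = (M - lam n'.-1).+1 & good M lam (n' + n')].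
  move=> nn'; apply: (@good_prefix_double p q) => //; last lia.
  by move=> d dM; apply: N0P => //; lia.
have ge_n k : (n <= 2 ^ k * n)%N by rewrite leq_pmull // expn_gt0.
have good_k k : good M lam (2 ^ k * n)%N.
  elim: k => [|k /(step _ (ge_n k))[_ _]]; first by rewrite mul1n.
  by rewrite addnn -mul2n mulnA -expnS.
have double k : (forall j, (j.+1 < 2 ^ k * n)%N ->
      lam (2 ^ k * n + j)%N = (M - lam j)%N) /\
    lam (2 ^ k * n + (2 ^ k * n).-1)%N = (M - lam (2 ^ k * n).-1).+1.
  by have [h1 h2 _] := step _ (ge_n k) (good_k k).
have [p' p'_in p'P] := close n; exists p' => //.
apply: hausdorff_dim_eq0 => s s0.
(* The level [K] depends on [s]: the blocks must be long enough for [block_set_null]. *)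
have [K Ks] : exists K, 2 < (2 ^ K * n)%:R * s.
  exists (Num.truncn (2 / s)).+1; rewrite -ltr_pdivrMr //.
  apply: lt_le_trans (truncnS_gt _) _; rewrite ler_nat.
  by apply: leq_trans (ltnW (ltn_expl _ (ltnSn 1))) _; rewrite leq_pmulr //; lia.
set L := (2 ^ K * n)%N in Ks.
(* There are countably many pairs of an initial word and a list of blocks; codes without exactly
   four blocks contribute the empty set. *)
pose F i : set R := if unpickle i is Some (pre, bs) then
  if size bs == 4 then value (M.+1%:R : R) @` block_set M L pre bs else set0
  else set0.
have null0 := hausdorff_measure_set0 s0.
apply: (hausdorff_null_bigcup (F := F)); last first.
  move=> i; rewrite /F; case: unpickle => [[pre bs]|//].
  by case: eqP => // bs4; exact: block_set_null.
move=> _ [d /p'P[k [y yE [[yM y_lt y_low] agree]]] <-].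
have dM := digit_of_ord d.
have ydom : dominated M lam y.
  split=> // j; split; first exact: y_lt.
  have [->|j0] := posnP j; last exact: y_low.
  (* For shift 0 the first digit [M - lam 0] of the reflection already decides. *)
  exists 0%N; split=> //; rewrite /reflect_seq /shift_seq agree //.
  exact: (good_head lam_max n1 n_good).
have y_start : starts_with n lam 0 y.
  by move=> i; rewrite mul1n => i_n; apply: agree; lia.
have [m [bs [bs4 ybs]]] := eventually_blocks lamM n1 double K ydom y_start.
have [bs' [bs'4 dbs]] : exists bs', size bs' = 4 /\
    block_decomposition L bs' (shift_seq (k + m) (fun i => d i : nat)).
  case: yE => yE.
    by exists bs; split=> //; move: ybs; rewrite yE shift_add.
  exists [seq mkseq (fun o => M - nth 0 b o)%N L | b <- bs]; rewrite size_map.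
  split=> //; apply: block_decomposition_reflect; first exact: digit_shift.
  by move: ybs; rewrite yE shift_add.
exists (pickle (mkseq (fun i => d i : nat) (k + m), bs')) => //.
rewrite /F pickleK bs'4 eqxx; exists (fun i => d i : nat) => //.
split=> // [i|]; rewrite size_mkseq // => ik.
by rewrite nth_mkseq.
Qed.

End ZeroDimension.

(** * Accumulation from the left *)

Section LeftAccumulation.
Variables (R : realType) (M : nat) (q : R).
Notation U := (univoque_base R M).

(** The left endpoint is the last point of [closure U] up to [p], or 1 if there is none beyond 1. *)
Lemma gap_left_of_closure (p : R) : 1 < p -> p < q -> q <= M.+1%:R ->
  closure U q -> U `&` `]p, q[ = set0 ->
  exists q0, [/\ 1 <= q0, q0 < q & components (univoque_gap R M) `]q0, q[%classic].
Proof.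
move=> p1 pq qM clq noU.
have nocl x : p < x -> x < q -> ~ closure U x.
  move=> px xq /(_ `]p, q[%classic)[|y [Uy y_in]].
    by apply: near_in_itvoo; rewrite in_itv /= px xq.
  by have : (U `&` `]p, q[%classic) y by []; rewrite noU.
pose S : set R := [set 1] `|` (closure U `&` [set x | x <= p]).
have S0 : S !=set0 by exists 1; left.
have pS : ubound S p by move=> x [->|[]//]; exact: ltW.
have Sclosed : closed S.
  apply: closedU; first exact: accessible_closed_set1 (hausdorff_accessible (@Rhausdorff R)) _.
  by apply: closedI; [exact: closed_closure|exact: closed_le].
have supS : S (sup S).
  by rewrite [S in S _](closure_id S).1 //; apply: closure_sup => //; exists p.
set q0 := sup S in supS.
have S_le x : S x -> x <= q0 by move=> Sx; apply: ub_le_sup => //; exists p.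
have q0_ge1 : 1 <= q0 by apply: S_le; left.
have q0_lep : q0 <= p by apply: ge_sup.
have q0q : q0 < q by lra.
have gapq0 : ~ univoque_gap R M q0.
  case=> + ncl; rewrite /= in_itv /= => /andP[+ _].
  by case: supS => [->|[]//]; rewrite ltxx.
have gapq : ~ univoque_gap R M q by case.
have gap_in : `]q0, q[%classic `<=` univoque_gap R M.
  move=> x; rewrite /= in_itv /= => /andP[q0x xq]; split.
    by rewrite /= in_itv /=; apply/andP; split; lra.
  have [xp clx|px] := leP x p; last exact: nocl.
  by have := S_le x (or_intror (conj clx xp)); lra.
pose x0 := (p + q) / 2.
have x0_in : `]q0, q[%classic x0 by rewrite /= in_itv /= /x0; apply/andP; split; lra.
exists q0; split=> //; exists x0; first exact: gap_in.
apply/seteqP; split; last first.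
  apply: connected_component_max => //; apply/connected_intervalP.
  exact: interval_is_interval.
(* The component is an interval, and neither [q0] nor [q] belongs to the gap set, so it cannot
   extend past them. *)
have /connected_intervalP itv := @component_connected _ (univoque_gap R M) x0.
have x0C : connected_component (univoque_gap R M) x0 x0.
  by apply: connected_component_refl; exact: gap_in.
move=> z zC; move: x0_in; rewrite /= !in_itv /= => /andP[q0x0 x0q].
apply/andP; split; rewrite ltNge; apply/negP => le.
  apply/gapq0/(@connected_component_sub _ _ x0)/(itv z x0) => //.
  by rewrite le ltW.
apply/gapq/(@connected_component_sub _ _ x0)/(itv x0 z) => //.
by rewrite le ltW.
Qed.

Lemma left_accumulationP : 1 < q <= M.+1%:R ->
  [/\ closure U q, q <> komornik_loreti R M
    & forall q0 : R, components (univoque_gap R M) `]q0, q[%classic ->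
        `]q0, q[%classic = `]1, komornik_loreti R M[%classic] <->
  (forall p, 1 < p < q -> U `&` `]p, q[ !=set0).
Proof.
move=> /andP[q1 qM]; split=> [[clq qkl gap] p /andP[p1 pq]|acc].
  apply/set0P/eqP => noU.
  have [q0 [q0_ge1 q0q /gap E]] := gap_left_of_closure p1 pq qM clq noU.
  (* Equality of the two nonempty intervals forces [q = kl]. *)
  set kl := komornik_loreti R M in qkl E.
  have mid : `]q0, q[%classic ((q0 + q) / 2).
    by rewrite /= in_itv /=; apply/andP; split; lra.
  have [mid1 midk] : 1 < (q0 + q) / 2 /\ (q0 + q) / 2 < kl.
    by move: mid; rewrite E /= in_itv /= => /andP[].
  have [lt|lt|//] := ltgtP q kl.
    have : `]1, kl[%classic q by rewrite /= in_itv /= q1.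
    by rewrite -E /= in_itv /= ltxx andbF.
  have : `]q0, q[%classic kl by rewrite /= in_itv /=; apply/andP; split; lra.
  by rewrite E /= in_itv /= ltxx andbF.
split.
- move=> B /nbhs_ballP[e /= e0 eB].
  pose p := Num.max ((1 + q) / 2) (q - e).
  have [|u [Uu]] := acc p.
    by rewrite /p lt_max gt_max; apply/andP; split; [|apply/andP; split]; lra.
  rewrite /= in_itv /= /p gt_max => /andP[/andP[_ u1] uq]; exists u; split=> //.
  by apply: eB; rewrite /ball /= ger0_norm; lra.
- rewrite /komornik_loreti; set P := _ `&` _ => qE.
  have [[x Px]|no] := pselect (exists x, P x).
    have [_ lbq] : P q by rewrite qE; exact: xgetPex (ex_intro _ x Px).
    have [|u [/lbq qu]] := acc ((1 + q) / 2); first by apply/andP; split; lra.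
    by rewrite /= in_itv /= => /andP[]; lra.
  (* If there were no smallest univoque base, [komornik_loreti] would be the default 0, while
     [q > 1]. *)
  have := xgetPN 0 (fun x Px => no (ex_intro _ x Px)); rewrite -qE; lra.
- move=> q0 [x Ax E].
  have x_in : `]q0, q[%classic x by rewrite -E; exact: connected_component_refl.
  move: x_in; rewrite /= in_itv /= => /andP[q0x xq].
  have x1 : 1 < x by case: Ax; rewrite /= in_itv /= => /andP[].
  have [|u [Uu]] := acc x; first by rewrite x1.
  rewrite /= in_itv /= => /andP[xu uq].
  have : `]q0, q[%classic u by rewrite /= in_itv /= uq (lt_trans q0x).
  by rewrite -E => /connected_component_sub[_ []]; apply: subset_closure.
Qed.

End LeftAccumulation.

(** * Equivalence of the three conditions through accumulation of univoque bases from the left *)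

Theorem theorem1p2 (R : realType) (M : nat) (hM : (1 <= M)%N) (q : R)
    (hq : 1 < q <= M.+1%:R) :
  ([/\ closure (univoque_base R M) q,
       q <> komornik_loreti R M
     & forall q0 : R, components (univoque_gap R M) `]q0, q[%classic ->
         `]q0, q[%classic = `]1, komornik_loreti R M[%classic]
   <->
   (forall p : R, 1 < p < q ->
      (0 < hausdorff_dim
             (pi_base (M.+1%:R : R) @`
                (univoque_seq M q `\` univoque_seq M p)))%E))
  /\
  ((forall p : R, 1 < p < q ->
      (0 < hausdorff_dim
             (pi_base (M.+1%:R : R) @`
                (univoque_seq M q `\` univoque_seq M p)))%E)
   <->
   (forall p : R, 1 < p < q ->
      (0 < hausdorff_dim (univoque_base R M `&` `]p, q[%classic))%E)).
Proof.
have [q1 qM] := andP hq.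
have dims : (forall p, 1 < p < q -> univoque_base R M `&` `]p, q[ !=set0) ->
    forall p : R, 1 < p < q ->
    (0 < hausdorff_dim (univoque_base R M `&` `]p, q[%classic))%E /\
    (0 < hausdorff_dim (pi_base (M.+1%:R : R) @`
      (univoque_seq M q `\` univoque_seq M p)))%E.
  move=> acc p /[dup] /acc[r [rU]]; rewrite /= in_itv /= => /andP[pr rq] /andP[p1 pq].
  exact: (univoque_base_dims hM p1 pr rq qM rU).
have acc2 : (forall p : R, 1 < p < q ->
      (0 < hausdorff_dim (pi_base (M.+1%:R : R) @`
         (univoque_seq M q `\` univoque_seq M p)))%E) ->
    forall p, 1 < p < q -> univoque_base R M `&` `]p, q[ !=set0.
  move=> pos p /andP[p1 pq]; apply/set0P/eqP => noU.
  by have [p' /pos] := zero_dimension hM p1 pq qM noU.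
have acc3 : (forall p : R, 1 < p < q ->
      (0 < hausdorff_dim (univoque_base R M `&` `]p, q[%classic))%E) ->
    forall p, 1 < p < q -> univoque_base R M `&` `]p, q[ !=set0.
  move=> pos p /pos dim; apply/set0P/eqP => noU.
  by move: dim; rewrite noU; exact: hausdorff_dim_set0.
rewrite left_accumulationP //; split; split.
- by move=> /dims h p /h[].
- exact: acc2.
- by move=> /acc2/dims h p /h[].
- by move=> /acc3/dims h p /h[].
Qed.
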